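(* Let $3\le s\le k$ be integers and $u$ a totally real algebraic integer with $2<u<14$. Consider the $4\times4$ symmetric matrix $A$ indexed by $e_1,\dots,e_4$ with diagonal entries $-2$ and off-diagonal entries $a_{12}=u$, $a_{13}=2\cos\frac{\pi}{s}$, $a_{24}=2\cos\frac{\pi}{k}$, $a_{14}=a_{23}=a_{34}=0$ (a path $e_3-e_1-e_2-e_4$). Assume $A$ is V-arithmetic with ground field $\mathbb K$. Then $[\mathbb K:\mathbb Q]\le25$ for $s=k=3$; $[\mathbb K:\mathbb Q]\le21$ for $s=3,k=7$; $[\mathbb K:\mathbb Q]\le21$ for $s=k=7$; and $[\mathbb K:\mathbb Q]\le20$ for all other $3\le s\le k$. In particular $[\mathbb K:\mathbb Q]\le25$ always.
   Context: A fundamental matrix is a real symmetric matrix $A=(a_{ij})$ with $a_{ii}=-2$, $a_{ij}\ge0$ for $i\ne j$, and $a_{ij}=2\cos(\pi/m_{ij})$ for an integer $m_{ij}\ge2$ whenever $a_{ij}<2$. It is hyperbolic if it has exactly one positive eigenvalue. Its cyclic products are $a_{i_1i_2}a_{i_2i_3}\cdots a_{i_ki_1}$; its ground field $\mathbb K$ is the field generated over $\mathbb Q$ by all cyclic products. A hyperbolic fundamental matrix is V-arithmetic if all cyclic products are algebraic integers, the field $\mathbb Q(\{a_{ij}\})$ is totally real, and for every embedding $\varphi:\mathbb Q(\{a_{ij}\})\to\mathbb R$ whose restriction to $\mathbb K$ is not the identity inclusion, the matrix $(\varphi(a_{ij}))$ is negative definite. All fields are regarded as subfields of $\mathbb R$.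 *)

(* Defs.v *)
(* All numbers live in algC (algebraic complex numbers);
   "subfields of R" are modelled by real elements of algC (x \is Creal). *)
From HB Require Import structures.
From mathcomp Require Import all_boot all_order all_algebra all_field.
Set Implicit Arguments. Unset Strict Implicit. Unset Printing Implicit Defensive.
Import Order.TTheory GRing.Theory Num.Theory.
Local Open Scope ring_scope.

(* 2 cos(pi/m) = z + conj z with z = m.-root (-1) = exp(i pi/m) *)
Definition two_cos_pi_div (m : nat) : algC :=
  let z := m.-root (-1) in z + z^*.

Inductive gen_field (S : algC -> Prop) : algC -> Prop :=
| gf_rat (q : rat) : gen_field S (ratr q)
| gf_gen x : S x -> gen_field S x
| gf_add x y : gen_field S x -> gen_field S y -> gen_field S (x + y)
| gf_opp x : gen_field S x -> gen_field S (- x)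
| gf_mul x y : gen_field S x -> gen_field S y -> gen_field S (x * y)
| gf_inv x : gen_field S x -> gen_field S x^-1.

Definition cyclic_prod (n : nat) (A : 'M[algC]_n) (s : seq 'I_n) : algC :=
  \prod_(p <- zip s (rot 1 s)) A p.1 p.2.

Definition is_cyclic_prod (n : nat) (A : 'M[algC]_n) (x : algC) : Prop :=
  exists2 s : seq 'I_n, s != [::] & x = cyclic_prod A s.

Definition ground_field (n : nat) (A : 'M[algC]_n) : algC -> Prop :=
  gen_field (is_cyclic_prod A).

Definition entry_field (n : nat) (A : 'M[algC]_n) : algC -> Prop :=
  gen_field (fun x => exists i j, x = A i j).

Definition degree_le (K : algC -> Prop) (d : nat) : Prop :=
  forall xs : seq algC, (forall x, x \in xs -> K x) -> (d < size xs)%N ->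
    exists c : seq rat, [/\ size c = size xs, c != nseq (size xs) 0 &
      \sum_(i < size xs) ratr c`_i * xs`_i = 0].

Definition hyperbolic (n : nat) (A : 'M[algC]_n) : Prop :=
  exists rs : seq algC,
    char_poly A = \prod_(r <- rs) ('X - r%:P) /\ count (fun r => 0 < r) rs = 1%N.

(* Negative definite (real symmetric matrix): x^T M x < 0 for every nonzero
   real vector x (real algebraic vectors suffice). *)
Definition neg_definite (n : nat) (M : 'M[algC]_n) : Prop :=
  forall x : 'cV[algC]_n, (forall i, x i 0 \is Creal) -> x != 0 ->
    (x^T *m M *m x) 0 0 < 0.

(* Field embeddings into C of subfields of algC are exactly restrictions of
   ring endomorphisms (= automorphisms) of algC. *)
Definition V_arithmetic (n : nat) (A : 'M[algC]_n) : Prop :=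
  [/\ hyperbolic A,
      (forall x, is_cyclic_prod A x -> x \in Aint),
      (forall (sigma : {rmorphism algC -> algC}) x,
          entry_field A x -> sigma x \is Creal) &
      (forall sigma : {rmorphism algC -> algC},
          (exists x, ground_field A x /\ sigma x <> x) ->
          neg_definite (map_mx sigma A))].

Definition totally_real (u : algC) : Prop :=
  forall sigma : {rmorphism algC -> algC}, sigma u \is Creal.

(* The 4x4 matrix, indices 0,1,2,3 <-> e1,e2,e3,e4; path e3 - e1 - e2 - e4. *)
Definition pathA (u : algC) (s k : nat) : 'M[algC]_4 :=
  \matrix_(i < 4, j < 4)
    if i == j then -2
    else match nat_of_ord i, nat_of_ord j with
         | 0%N, 1%N | 1%N, 0%N => u
         | 0%N, 2%N | 2%N, 0%N => two_cos_pi_div s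
         | 1%N, 3%N | 3%N, 1%N => two_cos_pi_div k
         | _, _ => 0
         end.

(* Main.v *)
(* Put a = u^2, g = 4 - (2 cos (pi/s))^2, h = 4 - (2 cos (pi/k))^2.  If an
   automorphism sigma moves an element of the ground field K, then negative
   definiteness of the conjugate matrix gives
     0 < 4 sigma(a) < sigma(g) sigma(h) < 16,
   whereas 4 < a < 196.  So an automorphism fixing a fixes K, that is K = Q(a),
   and each of the N - 1 nontrivial conjugates of a satisfies these inequalities,
   where N = [K : Q].

   A nonzero algebraic integer F of K has norm at least 1 in absolute value.  Taking
   for F a product of powers of a and of integers a + c with c in Z[g, h], chosen so
   that |F| <= B g^i h^j on the region 0 < 4 a < g h, one gets
     1 <= |F| B^(N - 1) (norm of g / g)^i (norm of h / h)^j.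
   Here F is bounded at the identity because a < 196, and h is a unit unless k is a
   prime power p^l, in which case h^(phi(k) / 2) is an associate of p; moreover
   phi(k) divides 2 N.  For k outside 3, 4, 5, 7 one uses
   F = (a (h - a))^4 (h - 2 a)^2 with h >= 12 / k^2 and phi(k)^3 >= 2 k^2 / 9, and the
   remaining pairs have their own F, whose bound B is checked on a grid. *)
Require Import Defs.
From HB Require Import structures.
From mathcomp Require Import all_boot all_order all_algebra all_field all_fingroup.
From mathcomp Require Import ssrZ zify ring lra.
From Stdlib Require Import BinInt.
(* [BinInt] rebinds the key [N] to the binary naturals. *)
Delimit Scope nat_scope with N.
Set Implicit Arguments. Unset Strict Implicit. Unset Printing Implicit Defensive.
Import Order.TTheory GRing.Theory Num.Theory.
Local Open Scope ring_scope.

(** * Number fields *)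

(** If [k] is a power of [p] and [n = phi(k) / 2], then [N = n r] and the norm of [h] is at most
    [p^r], so a bound [B h^j] pays only when [B^n p^j] is well below 1. For the generic [F] this
    number is the fifth power of [p^2 / 5^n], which is at least 1 for [k] = 3 and 5, and not small
    enough at [N = 21] for 4 and 7. Hence these four indices are set apart. As [g, h < 4], the
    inequality [4 a < g h] gives both [a < g] and [a < h], so one generic index, or one index 4,
    settles a pair, and only pairs from 3, 5, 7 remain. There the zeros of [F] are placed in the
    intervals open to the conjugates of [a], one interval for each choice of conjugates of [g] and
    [h]; divisibility, [N = 2 r] or [N = 3 r], turns [r <= 10] and [r <= 7] into 20 and 21. A second
    obstacle is that [k.-root (-1)] is specified only as the solution of [z^k = -1] in the upper
    half plane with the largest real part. That it is a primitive [2 k]-th root of unity, and that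
    [2 cos (pi / k)] is at least 1, is derived from this maximality. *)

(** [L] is the splitting field of the minimal polynomial of a primitive element [z] for [s]. It is
    Galois because the characteristic is 0, and every element of [s] is a rational polynomial in
    [z]. *)
Lemma galois_number_field (s : seq algC) :
  exists (L : splittingFieldType rat) (iota : {rmorphism L -> algC}),
    galois 1 {:L} /\ forall x, x \in s -> exists y, iota y = x.
Proof.
have [z _ /sig_eqW[ps Ds]] := algC_PET s.
have [p [Dp mon_p] min_p] := minCpolyP z.
have [r Dr] := closed_field_poly_normal (minCpoly z).
rewrite (monicP (minCpoly_monic z)) scale1r in Dr.
have [L [iota [rr Drr genL]]] := num_field_exists r.
have Dmap (q : {poly rat}) : map_poly iota (map_poly (in_alg L) q) = map_poly ratr q.
  rewrite -map_poly_comp; apply: eq_map_poly => a.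
  by rewrite /= rmorphZ_num rmorph1 mulr1.
have Dprr : map_poly (in_alg L) p = \prod_(y <- rr) ('X - y%:P).
  apply: (map_poly_inj iota); rewrite Dmap -Dp Dr -Drr big_map rmorph_prod /=.
  by apply: eq_bigr => y _; rewrite map_polyXsubC.
have Lax : FieldExt_isSplittingField _ L.
  constructor; exists (map_poly (in_alg L) p); first exact: alg_polyOver.
  by exists rr => //; rewrite Dprr eqpxx.
pose L' : splittingFieldType rat := HB.pack_for (splittingFieldType rat) L Lax.
exists L', iota; split.
  apply/and3P; split; [exact: sub1v | | exact: normalFieldf].
  apply/separableP => y _; apply: pcharf0_separable => q.
  apply/negbTE/negP => /andP[/prime_gt0 q_gt0].
  by rewrite -(fmorph_eq0 iota) rmorph_nat pnatr_eq0 eqn0Ngt q_gt0.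
have [zL DzL] : exists zL, iota zL = z.
  have: z \in r by rewrite -root_prod_XsubC -Dr root_minCpoly.
  by rewrite -Drr => /mapP[y _ ->]; exists y.
move=> x; rewrite Ds => /mapP[q _ ->].
by exists (map_poly (in_alg L) q).[zL]; rewrite -horner_map Dmap DzL.
Qed.

Section NumberField.

Variables (L : splittingFieldType rat) (iota : {rmorphism L -> algC}).
Hypothesis galL : galois 1 {:L}.

(** Arithmeticity speaks of endomorphisms of [algC], so automorphisms of [L] have to be extended
    before it applies to them. *)
Lemma gal_lift (s : gal_of {:L}) :
  exists nu : {rmorphism algC -> algC}, forall x, nu (iota x) = iota (s x).
Proof.
have [nu Dnu] := extend_algC_subfield_aut iota (s : {rmorphism L -> L}).
by exists nu => x; rewrite -Dnu.
Qed.

(** Galois correspondence: [Q(a)] is the fixed field of its group in [L], and every member of that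
    group lifts to some [nu] fixing [iota a]. *)
Lemma fixed_mem_Fadjoin (a x : L) :
  (forall nu : {rmorphism algC -> algC}, nu (iota a) = iota a ->
     nu (iota x) = iota x) -> x \in <<1; a>>%VS.
Proof.
move=> fix_x.
have galLa : galois <<1; a>> {:L}.
  by apply: galoisS galL; rewrite sub1v subvf.
rewrite -(galois_fixedField galLa); apply/fixedFieldP; first exact: memvf.
move=> s s_gal; have [nu Dnu] := gal_lift s.
apply: (fmorph_inj iota); rewrite -Dnu fix_x // Dnu.
by rewrite (fixed_gal _ s_gal) ?subvf ?memv_adjoin.
Qed.

Lemma dependent_dim (K : {vspace L}) (ys : seq L) :
  {subset ys <= K} -> (\dim K < size ys)%N ->
  exists c : seq rat, [/\ size c = size ys, c != nseq (size ys) 0 &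
      \sum_(i < size ys) ratr c`_i * iota ys`_i = 0].
Proof.
move=> ysK lt_dim.
set n := size ys; pose b := vbasis K.
pose M := \matrix_(i < n, j < \dim K) coord b j ys`_i.
have : kermx M != 0.
  rewrite kermx_eq0 /row_free; apply/negP => /eqP rkM.
  by have := rank_leq_col M; rewrite rkM leqNgt lt_dim.
case/rowV0Pn => v /sub_kermxP vM0 nz_v.
exists [seq v 0 i | i <- enum 'I_n]; have szc : size [seq v 0 i | i <- enum 'I_n] = n.
  by rewrite size_map size_enum_ord.
have nthc (i : 'I_n) : [seq v 0 i | i <- enum 'I_n]`_i = v 0 i.
  by rewrite (nth_map i) ?size_enum_ord // nth_ord_enum.
split=> //.
  apply: contra nz_v => /eqP c0; apply/eqP/rowP => i.
  by rewrite -nthc c0 nth_nseq ltn_ord mxE.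
have -> : \sum_(i < n) ratr [seq v 0 i | i <- enum 'I_n]`_i * iota ys`_i
    = iota (\sum_(i < n) v 0 i *: ys`_i).
  rewrite rmorph_sum; apply: eq_bigr => i _.
  by rewrite nthc rmorphZ_num.
rewrite (_ : \sum_(i < n) _ = 0) ?rmorph0 //.
transitivity (\sum_(j < \dim K) (v *m M) 0 j *: b`_j); last first.
  by rewrite vM0 big1 // => j _; rewrite mxE scale0r.
transitivity (\sum_(i < n) \sum_(j < \dim K) (v 0 i * M i j) *: b`_j).
  apply: eq_bigr => i _; rewrite {1}(coord_vbasis (ysK _ (mem_nth 0 (ltn_ord i)))).
  by rewrite scaler_sumr; apply: eq_bigr => j _; rewrite scalerA mxE.
by rewrite exchange_big; apply: eq_bigr => j _; rewrite mxE scaler_suml.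
Qed.

(* Each embedding of [K = Q(a)] occurs [e = [L : K]] times among the
   restrictions of the automorphisms of [L]. *)
Lemma norm_ge1_conjugates (a : L) :
  exists (e m : nat) (sg : 'I_m -> {rmorphism algC -> algC}),
    [/\ (0 < e)%N, m = (e * (\dim <<1; a>>).-1)%N,
      forall i, sg i (iota a) != iota a &
      forall x, x \in <<1; a>>%VS -> iota x \in Aint -> x != 0 ->
        1 <= `|iota x| ^+ e * \prod_(i < m) `|sg i (iota x)|].
Proof.
set K := <<1; a>>%AS.
have galLa : galois K {:L} by apply: galoisS galL; rewrite sub1v subvf.
pose H := 'Gal({:L} / K)%G; pose G := 'Gal({:L} / 1)%G.
have sHG : H \subset G by rewrite galS ?sub1v.
have /fin_all_exists[nu Dnu] (s : gal_of {:L}) := gal_lift s.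
have memH s : s \in G -> (s \in H) = (s a == a).
  move=> _; rewrite gal_kHom ?subvf //; apply/idP/eqP=> [/kAHomP/(_ a)->//|sa].
    exact: memv_adjoin.
  apply/kAHomP => x /Fadjoin_polyP[p /polyOver1P[q ->] ->].
  rewrite -horner_map /= sa; congr _.[_].
  rewrite -map_poly_comp; apply: eq_map_poly => c /=.
  by rewrite linearZ /= rmorph1.
have dimG : (#|G :\: H| = #|H| * (\dim K).-1)%N.
  rewrite cardsD (setIidPr sHG) -(galois_dim galL) dimv1 divn1.
  by rewrite (dim_sup_field (subvf K)) (galois_dim galLa) -subn1 mulnBr muln1.
exists #|H|, #|G :\: H|, (fun i => nu (enum_val i)); split=> //.
- move=> i; have := enum_valP i; rewrite inE => /andP[nH Gi].
  by rewrite Dnu (inj_eq (fmorph_inj iota)) -memH.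
move=> x Kx Zx nz_x.
(* Automorphisms in [H] fix [x] and give the power of [iota x]; the rest of [G] gives the product
   over the [sg i]. *)
have -> : `|iota x| ^+ #|H| * \prod_(i < #|G :\: H|) `|nu (enum_val i) (iota x)|
  = `|iota (galNorm 1 {:L} x)|.
  rewrite rmorph_prod normr_prod (bigID (mem H)) /=; congr (_ * _).
    rewrite (eq_bigl (mem H)); last by move=> s; apply/andb_idl/(subsetP sHG).
    rewrite -prodr_const; apply: eq_bigr => s Hs.
    by rewrite (fixed_gal _ Hs) ?subvf.
  rewrite (eq_bigl (mem (G :\: H))); last by move=> s; rewrite !inE andbC.
  by rewrite [RHS]big_enum_val; apply: eq_bigr => i _; rewrite Dnu.
apply: norm_intr_ge1; last first.
  by rewrite fmorph_eq0 galNorm_eq0.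
apply: Cint_rat_Aint.
  have /vlineP[/= c ->] := mem_galNorm galL (memvf x).
  by rewrite alg_num_field fmorph_rat rpred_rat.
rewrite rmorph_prod rpred_prod // => s _.
by rewrite -Dnu Aint_aut.
Qed.

End NumberField.

Section Degrees.

Variables (L : splittingFieldType rat) (iota : {rmorphism L -> algC}).

(** Both minimal polynomials come from rational polynomials that divide each other. The cyclotomic
    degree is known for [minCpoly], and this carries it over to subfields of [L]. *)
Lemma dim_Fadjoin1 (a : L) : \dim <<1; a>> = (size (minCpoly (iota a))).-1.
Proof.
have Dmap (q : {poly rat}) : map_poly iota (map_poly (in_alg L) q) = map_poly ratr q.
  rewrite -map_poly_comp; apply: eq_map_poly => c.
  by rewrite /= rmorphZ_num rmorph1 mulr1.
rewrite dim_Fadjoin dimv1 muln1 -[LHS]/(adjoin_degree 1 a).+1.-1 -size_minPoly.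
congr _.-1; have [p [-> mon_p] min_p] := minCpolyP (iota a).
have /polyOver1P[q Dq] := minPolyOver 1 a.
have qp : (p %| q)%R.
  by rewrite -min_p -Dmap fmorph_root -Dq root_minPoly.
have pq : (q %| p)%R.
  rewrite -(dvdp_map (in_alg L)) -Dq minPoly_dvdp ?alg_polyOver //.
  by rewrite -(fmorph_root iota) Dmap min_p.
have nz_p : p != 0 by apply: monic_neq0.
have nz_q : q != 0.
  by rewrite -(map_poly_eq0 (in_alg L)) -Dq monic_neq0 ?monic_minPoly.
by rewrite size_map_poly Dq size_map_poly; apply/eqP; rewrite eqn_leq !dvdp_leq.
Qed.

(** [z] is a root of [X^2 - (z + z^-1) X + 1] over [K = Q(a)], so [K(z)] has degree 1 or 2 over [K],
    and it contains [Q(z)], of degree [totient k]. *)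
Lemma totient_dvd_dim (k : nat) (a z : L) :
  (0 < k)%N -> k.-primitive_root (iota z) -> z + z^-1 \in <<1; a>>%VS ->
  (totient k %| 2 * \dim <<1; a>>)%N.
Proof.
move=> k_gt0 prim_z Kz; set K := <<1; a>>%AS.
have nz_z : z != 0.
  rewrite -(fmorph_eq0 iota); apply/eqP => z0; have := prim_expr_order prim_z.
  by rewrite z0 expr0n gtn_eqF // => /eqP; rewrite eq_sym oner_eq0.
have deg_z : (adjoin_degree K z <= 2)%N.
  rewrite -ltnS -size_minPoly.
  have Dp : size ('X^2 - (z + z^-1) *: 'X + 1 : {poly L}) = 3%N.
    rewrite -addrA size_polyDl size_polyXn // (leq_ltn_trans (size_polyD _ _)) //.
    rewrite gtn_max size_poly1 /= size_polyN; apply/andP; split=> //.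
    by rewrite (leq_ltn_trans (size_scale_leq _ _)) ?size_polyX.
  rewrite -Dp dvdp_leq -?size_poly_eq0 ?Dp //; apply: minPoly_dvdp.
    by rewrite rpredD ?rpred1 // rpredB ?rpredX ?polyOverZ ?polyOverX.
  rewrite /root !hornerE; apply/eqP.
  by rewrite mulrDl mulVf // opprD addrA -expr2 subrr add0r addrC subrr.
have: (\dim <<1; z>> %| \dim <<K; z>>)%N.
  apply: field_dimS; apply/FadjoinP; split; last exact: memv_adjoin.
  exact: subv_trans (sub1v K) (subv_adjoin K z).
rewrite dim_Fadjoin1 (minCpoly_cyclotomic prim_z) size_cyclotomic /= dim_Fadjoin.
have : (0 < adjoin_degree K z)%N by []; case: (adjoin_degree K z) deg_z => [|[|[|]]] //= _ _.
by rewrite mul1n => /dvdn_mull->.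
Qed.

End Degrees.

(** * The principal root of -1 *)

(** For the points at angles [alpha] and [beta] of the upper half circle, [b c - a d] is
    [sin (alpha - beta)], and [a <= c] means [beta <= alpha]. *)
Lemma upper_half_circle_cross (R : realFieldType) (a b c d : R) :
  a ^+ 2 + b ^+ 2 = 1 -> c ^+ 2 + d ^+ 2 = 1 -> 0 <= b -> 0 < d -> a <= c ->
  ~ (a = c /\ b = d) -> 0 < b * c - a * d.
Proof.
move=> ab cd b0 d0 ac ne.
have [eac|/eqP nac] := eqVneq a c.
  have : (b - d) * (b + d) = 0 by rewrite -subr_sqr; rewrite eac in ab; lra.
  by move/eqP; rewrite mulf_eq0 => /orP[/eqP|/eqP] bd; [case: ne; split=> //|]; lra.
have {nac}ltac : a < c by rewrite lt_neqAle ac andbT; apply/eqP.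
have [c0|c0] := leP 0 c; have [a0|a0] := leP a 0.
- have [a0'|a0'] := eqVneq a 0; last first.
    have : a < 0 by rewrite lt_neqAle a0'.
    by move=> a0''; have := mulr_ge0 b0 c0; have := nmulr_rlt0 d a0''; rewrite d0; lra.
  have b1 : b = 1 by rewrite a0' in ab; nra.
  by rewrite a0' b1 in ltac *; lra.
- have bd : d < b.
    rewrite ltNge; apply/negP => bd; have := ler_pM b0 b0 bd bd.
    by have := ltr_pM (ltW a0) (ltW a0) ltac ltac; lra.
  by have := ltr_pM (ltW a0) (ltW d0) ltac bd; lra.
- have bd : b < d.
    rewrite ltNge; apply/negP => bd; have := ler_pM (ltW d0) (ltW d0) bd bd.
    have h : 0 < (c - a) * (- c - a) by rewrite mulr_gt0 //; lra.
    by lra.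
  have h1 : 0 < (d - b) * - c by rewrite mulr_gt0 //; lra.
  have h2 : 0 < (c - a) * d by rewrite mulr_gt0 //; lra.
  by lra.
- by lra.
Qed.

(** Suppose that some solution of [u^k = -1] is not a power of [z], and let [u] be such a solution
    with the largest real part, taken in the upper half plane by conjugation. Turning [u] by [z^-2]
    gives another such solution, and its real part is larger because the angle of [z] is the
    smallest one. *)
Lemma prim_root_rootCN1 (k : nat) :
  (1 < k)%N -> (2 * k).-primitive_root (k.-root (-1) : algC).
Proof.
move=> k_gt1; have k_gt0 := ltnW k_gt1; set z := k.-root (-1).
have zk : z ^+ k = -1 by rewrite rootCK.
have nz_z : z != 0 by rewrite rootC_eq0 // oppr_eq0 oner_eq0.
have zk2 : z ^+ (2 * k) = 1 by rewrite mulnC exprM zk sqrrN expr1n.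
have unit_circle (u : algC) : u ^+ k = -1 -> u^* = u^-1 /\ 'Re u ^+ 2 + 'Im u ^+ 2 = 1.
  move=> uk; have nu : `|u| = 1.
    by apply/eqP; rewrite -(@pexpr_eq1 _ _ k) // -normrX uk normrN1.
  by rewrite -normC2_Re_Im nu expr1n; split=> //; rewrite invC_norm nu expr1n invr1 mul1r.
have [zJ zc] := unit_circle z zk.
have [w prim_w] := @C_prim_root_exists (2 * k) (ltac:(by rewrite muln_gt0)).
have wk : w ^+ k = -1.
  have : (w ^+ k) ^+ 2 == 1 by rewrite -exprM mulnC prim_expr_order.
  rewrite sqrf_eq1 => /orP[|/eqP//].
  by rewrite -(prim_order_dvd prim_w) gtnNdvd // mul2n -addnn -{1}[k]add0n ltn_add2r.
pose pow_z u := [exists j : 'I_(2 * k), u == z ^+ j].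
have pow_zP u j : u = z ^+ j -> pow_z u.
  move=> ->; apply/existsP; rewrite -(expr_mod _ zk2).
  have lt : (j %% (2 * k) < 2 * k)%N by rewrite ltn_mod muln_gt0.
  by exists (Ordinal lt).
pose re (u : algC) : algR := in_algR (Creal_Re u).
pose im (u : algC) : algR := in_algR (Creal_Im u).
pose P (i : 'I_(2 * k)) := ((w ^+ i) ^+ k == -1) && ~~ pow_z (w ^+ i).
have ltac1 : (1 < 2 * k)%N by rewrite (leq_trans k_gt1) // leq_pmull.
(* The order of [z] divides [2 k]; if the primitive root [w] is a power of [z], the order is also a
   multiple of [2 k]. *)
suffices wz : pow_z w.
  have [m prim_m m_dv] := prim_order_exists (ltac:(by rewrite muln_gt0) : (0 < 2 * k)%N) zk2.
  have [j /eqP Dw] := existsP wz.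
  suffices <- : m = (2 * k)%N by [].
  apply/eqP; rewrite eqn_dvd m_dv (prim_order_dvd prim_w) Dw exprAC.
  by rewrite (prim_expr_order prim_m) expr1n eqxx.
apply: contraT => nwz.
have Pi0 : P (Ordinal ltac1) by rewrite /P /= expr1 wk eqxx.
pose i := [arg max_(i > Ordinal ltac1 | P i) re (w ^+ i)]%O.
have [/andP[/eqP uk nuz] u_max] : P i /\ forall j, P j -> re (w ^+ j) <= re (w ^+ i).
  by rewrite /i; case: (@Order.TotalTheory.arg_maxP _ algR _ _ P (fun i : 'I_(2 * k) => re (w ^+ i)) Pi0)
    => j Pj j_max; split=> // l /j_max.
have {u_max}u_max v : v ^+ k = -1 -> ~~ pow_z v -> 'Re v <= 'Re (w ^+ i).
  move=> vk nvz; have /(prim_rootP prim_w)[j Dv] : v ^+ (2 * k) = 1.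
    by rewrite mulnC exprM vk sqrrN expr1n.
  by have := u_max j; rewrite /P -Dv vk eqxx => /(_ nvz).
move: (w ^+ i) uk nuz u_max => {i} u.
wlog Iu : u / 0 <= 'Im u.
  move=> IH uk nuz u_max; have /orP[/IH|Iu] := real_leVge (real0 algC) (Creal_Im u); first exact.
  apply: (IH u^*).
  - by rewrite Im_conj oppr_ge0.
  - by rewrite -rmorphXn uk rmorphN1.
  - apply: contra nuz => /existsP[j /eqP Du]; apply: (@pow_zP _ ((2 * k).-1 * j)%N).
    rewrite -[LHS]conjCK Du rmorphXn /= zJ exprM; congr (_ ^+ _).
    by apply: (mulfI nz_z); rewrite -exprS prednK ?muln_gt0 // zk2 mulfV.
  - by move=> v vk nvz; rewrite Re_conj u_max.
move=> uk nuz u_max.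
have [_ uc] := unit_circle u uk.
have Iz : 0 <= 'Im z by apply: Im_rootC_ge0.
have uz : 'Re u <= 'Re z by apply: rootC_Re_max.
have nez : ~ ('Re u = 'Re z /\ 'Im u = 'Im z).
  by case=> e1 e2; case/negP: nuz; apply: (@pow_zP _ 1%N); rewrite expr1; apply/eqCP.
(* A real [z] is 1 or -1. The first contradicts [z^k = -1]; the second forces [u = -1 = z], since
   ['Re u <= 'Re z]. *)
have Iz_gt0 : 0 < 'Im z.
  rewrite lt_neqAle Iz andbT; apply/eqP => Iz0.
  have e := zc; rewrite -Iz0 expr0n addr0 in e.
  have /orP[/eqP Rz|/eqP Rz] : ('Re z == 1) || ('Re z == -1) by rewrite -sqrf_eq1 e.
    have z1 : z = 1 by rewrite [z]Crect -Iz0 Rz mulr0 addr0.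
    by have /eqP := zk; rewrite z1 expr1n -subr_eq0 opprK -[1 + 1]/(2%:R) pnatr_eq0.
  have [re1 im0] : re u = -1 /\ im u = 0.
    have h1 : re u ^+ 2 + im u ^+ 2 = 1 by apply: val_inj.
    have h2 : re u <= -1 by rewrite -[_ <= _]/('Re u <= -1) -Rz.
    have h3 : im u ^+ 2 = 0 by have := sqr_ge0 (im u); nra.
    by have := expf_eq0 (im u) 2; rewrite h3 eqxx /= => /esym/eqP h4; split=> //; nra.
  by apply: nez; rewrite -Iz0 Rz; split; [move/(congr1 val): re1 | move/(congr1 val): im0].
have lt0 : 0 < im u * re z - re u * im z.
  by apply: upper_half_circle_cross => //; try apply: val_inj => //=;
    case=> /(congr1 val) e1 /(congr1 val) e2; apply: nez.
have zzJ : z * z^* = 1.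
  by rewrite -normCK normC2_Re_Im.
have := u_max (u * z^* ^+ 2); rewrite exprMn uk -exprM mulnC exprM -rmorphXn zk.
rewrite rmorphN1 sqrrN expr1n mulr1 => /(_ erefl).
(* This is [cos (alpha - 2 beta) - cos alpha = 2 sin beta sin (alpha - beta)]. *)
rewrite (_ : 'Re (u * z^* ^+ 2) = 'Re u + 2 * 'Im z * ('Im u * 'Re z - 'Re u * 'Im z)); last first.
  rewrite expr2 !ReM !ImM !Re_conj !Im_conj.
  rewrite [X in _ = X + _](_ : _ = 'Re u * ('Re z ^+ 2 + 'Im z ^+ 2)); last by rewrite zc mulr1.
  by ring.
rewrite gerDl => /(_ _)/wrap[].
  apply: contra nuz => /existsP[j /eqP Du]; apply: (@pow_zP _ (j + 2)%N).
  by rewrite exprD -Du -mulrA -exprMn [_ * z]mulrC zzJ expr1n mulr1.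
by rewrite lt_geF // !mulr_gt0.
Qed.

(** * Cyclotomic integers *)

(** With [m = p^a] and [n = p m], the divisors of [n] are [n] and those of [m], so the cyclotomic
    polynomial is [(X^n - 1) / (X^m - 1)], a sum of [p] monomials. *)
Lemma Cyclotomic_prime_power_1 p a : prime p -> ('Phi_(p ^ a.+1)).[1] = p%:R.
Proof.
move=> p_pr; have p_gt0 := prime_gt0 p_pr; set m := (p ^ a)%N; set n := (p ^ a.+1)%N.
have m_gt0 : (0 < m)%N by rewrite expn_gt0 p_gt0.
have n_gt0 : (0 < n)%N by rewrite expn_gt0 p_gt0.
have ltmn : (m < n)%N by rewrite ltn_exp2l ?prime_gt1.
have Ddiv : perm_eq (divisors n) (n :: divisors m).
  apply: uniq_perm; rewrite ?divisors_uniq //=.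
    by rewrite divisors_uniq -dvdn_divisors // gtnNdvd.
  move=> d; rewrite inE -!dvdn_divisors //.
  apply/(dvdn_pfactor _ _ p_pr)/orP => [[b b_le ->]|[/eqP->|]].
  - move: b_le; rewrite leq_eqVlt => /orP[/eqP->|b_lt]; first by left.
    by right; rewrite dvdn_exp2l.
  - by exists a.+1.
  - by case/(dvdn_pfactor _ _ p_pr) => b b_le ->; exists b; rewrite // leqW.
have : 'Phi_n * ('X^m - 1) = (\sum_(i < p) 'X^(m * i)) * ('X^m - 1) :> {poly int}.
  rewrite -(prod_Cyclotomic m_gt0) -(big_cons _ _ n (divisors m) xpredT) /=.
  rewrite -(perm_big _ Ddiv) /= prod_Cyclotomic // prod_Cyclotomic // mulrC.
  rewrite /n expnSr exprM subrX1; congr (_ * _).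
  by apply: eq_bigr => i _; rewrite exprM.
move/(mulIf (_ : 'X^m - 1 != 0))-> => [|]; last by rewrite monic_neq0 ?monicXnsubC.
rewrite -horner_evalE rmorph_sum /= (eq_bigr (fun _ => 1)); last first.
  by move=> i _; rewrite horner_evalE hornerXn expr1n.
by rewrite sumr_const card_ord.
Qed.

Lemma prod_1_sub_prim (n : nat) (w : algC) :
  n.-primitive_root w -> \prod_(1 <= i < n) (1 - w ^+ i) = n%:R.
Proof.
move=> prim_w; have n_gt0 := prim_order_gt0 prim_w.
have : \prod_(1 <= i < n) ('X - (w ^+ i)%:P) = \sum_(i < n) 'X^i.
  apply: (@mulfI _ ('X - 1)); first by rewrite -size_poly_eq0 size_XsubC.
  rewrite -subrX1 -(factor_Xn_sub_1 prim_w) [RHS]big_ltn //.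
move/(congr1 (fun p => p.[1])); rewrite horner_prod => e.
transitivity (\prod_(1 <= i < n) ('X - (w ^+ i)%:P).[1]).
  by apply: eq_bigr => i _; rewrite !hornerE.
rewrite e -horner_evalE rmorph_sum /= (eq_bigr (fun _ => 1)); last first.
  by move=> i _; rewrite horner_evalE hornerXn expr1n.
by rewrite sumr_const card_ord.
Qed.

Lemma Aint_geom (w : algC) n : w \in Aint -> w != 1 -> (1 - w ^+ n) / (1 - w) \in Aint.
Proof.
move=> Zw nw1; have nz : w - 1 != 0 by rewrite subr_eq0.
rewrite -opprB -[1 - w]opprB invrN mulrNN subrX1 mulrAC mulfV // mul1r.
by rewrite rpred_sum // => i _; rewrite rpredX.
Qed.

Lemma prim_neq1 (k : nat) (z : algC) : (1 < k)%N -> k.-primitive_root z -> z != 1.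
Proof.
by move=> k_gt1 prim_z; rewrite -[z]expr1 -(prim_order_dvd prim_z) gtnNdvd.
Qed.

(** [w = z^(k / p)] has order [p], and [p] is the product of the [1 - w^i]. Its factor [1 - w] is a
    multiple of [1 - z]. *)
Lemma prime_div_1_sub_prim (k p : nat) (z : algC) :
  k.-primitive_root z -> prime p -> (p %| k)%N -> p%:R / (1 - z) \in Aint.
Proof.
move=> prim_z p_pr p_k; have k_gt0 := prim_order_gt0 prim_z.
have p_gt1 := prime_gt1 p_pr; have k_gt1 := leq_trans p_gt1 (dvdn_leq k_gt0 p_k).
have prim_w := dvdn_prim_root prim_z p_k; set w := z ^+ _ in prim_w.
have Zz := Aint_prim_root prim_z; have Zw := Aint_prim_root prim_w.
have nz_w : 1 - w != 0 by rewrite subr_eq0 eq_sym (prim_neq1 p_gt1).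
rewrite -(prod_1_sub_prim prim_w) big_ltn // expr1 mulrC mulrA mulrC.
rewrite rpredM ?[_^-1 * _]mulrC ?Aint_geom ?(prim_neq1 k_gt1) //.
by rewrite rpred_prod // => i _; rewrite rpredB ?rpred1 ?rpredX.
Qed.

(** [1 - z] divides both [p] and [q], hence 1 by Bezout. *)
Lemma inv_1_sub_prim_Aint (k p q : nat) (z : algC) :
  k.-primitive_root z -> prime p -> prime q -> p != q ->
  (p %| k)%N -> (q %| k)%N -> (1 - z)^-1 \in Aint.
Proof.
move=> prim_z p_pr q_pr npq p_k q_k.
have co_pq : coprime p q by rewrite prime_coprime // dvdn_prime2.
have [u v Duv _] := egcdnP q (prime_gt0 p_pr).
have {Duv}Duv : (u * p = v * q + 1)%N by rewrite Duv (eqP co_pq).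
have -> : (1 - z)^-1 = u%:R * (p%:R / (1 - z)) - v%:R * (q%:R / (1 - z)).
  by rewrite !mulrA -mulrBl -!natrM Duv natrD addrAC subrr add0r mul1r.
by rewrite rpredB // rpredM ?rpred_nat // (prime_div_1_sub_prim prim_z).
Qed.

(** [p] is the value at 1 of the cyclotomic polynomial, the product of the [1 - z^i] with [i] prime
    to [k], and each of these factors is a multiple of [1 - z]. *)
Lemma prime_power_div_1_sub_prim (p a : nat) (z : algC) (k := (p ^ a.+1)%N) :
  prime p -> k.-primitive_root z -> p%:R / (1 - z) ^+ totient k \in Aint.
Proof.
move=> p_pr prim_z; have p_gt1 := prime_gt1 p_pr.
have k_gt1 : (1 < k)%N by rewrite -(exp1n a.+1) ltn_exp2r.
have Zz := Aint_prim_root prim_z.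
have -> : p%:R = \prod_(i < k | coprime i k) (1 - z ^+ i).
  transitivity ((map_poly intr 'Phi_k : {poly algC}).[1]).
    by rewrite -[1]/(1%:~R) horner_map Cyclotomic_prime_power_1 // rmorph_nat.
  rewrite (Cintr_Cyclotomic prim_z) horner_prod; apply: eq_bigr => i _.
  by rewrite !hornerE.
have -> : totient k = #|[pred i : 'I_k | coprime i k]|.
  rewrite totient_count_coprime -big_mkcond big_mkord -sum1_card.
  by apply: eq_bigl => i; rewrite coprime_sym.
rewrite -prodr_const -prodf_div.
by rewrite rpred_prod // => i _; rewrite Aint_geom // (prim_neq1 k_gt1).
Qed.

(** * The numbers 4 - (2 cos (pi / k))^2 *)

(** On the unit circle this is [|1 - z|^2]. At [z = exp (2 pi i / k)] it equals
    [4 - (2 cos (pi / k))^2], and its conjugates are its values at the other primitive [k]-th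
    roots. *)
Definition gam (z : algC) : algC := 2 - (z + z^-1).

Lemma gamE (z : algC) : z != 0 -> gam z = (1 - z) * (1 - z^-1).
Proof. by move=> nz; rewrite /gam; field. Qed.

(** [gam z] is [(1 - z)^2] up to a unit, so half of the exponent [totient k] is enough for [gam]. *)
Lemma gam_sqr (z : algC) : z != 0 -> gam z = - z^-1 * (1 - z) ^+ 2.
Proof. by move=> nz; rewrite gamE //; field. Qed.

Lemma unity_Aint_inv (k : nat) (z : algC) : k.-primitive_root z -> z^-1 \in Aint.
Proof.
move=> prim_z; have k_gt0 := prim_order_gt0 prim_z.
have nz : z != 0 by rewrite (prim_root_eq0 prim_z) -lt0n.
have -> : z^-1 = z ^+ k.-1.
  by apply: (mulfI nz); rewrite mulfV // -exprS prednK // prim_expr_order.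
by rewrite rpredX // (Aint_prim_root prim_z).
Qed.

Lemma gam_inv_Aint (k p q : nat) (z : algC) :
  k.-primitive_root z -> prime p -> prime q -> p != q ->
  (p %| k)%N -> (q %| k)%N -> (gam z)^-1 \in Aint.
Proof.
move=> prim_z p_pr q_pr npq p_k q_k; have Zi := inv_1_sub_prim_Aint prim_z p_pr q_pr npq p_k q_k.
have nz : z != 0 by rewrite (prim_root_eq0 prim_z) -lt0n (prim_order_gt0 prim_z).
rewrite gam_sqr // invfM invrN invrK -exprVn mulNr rpredN rpredM ?rpredX //.
exact: Aint_prim_root prim_z.
Qed.

Lemma gam_exp_prime_power (p a n : nat) (z : algC) (k := (p ^ a.+1)%N) :
  prime p -> k.-primitive_root z -> (totient k = 2 * n)%N ->
  p%:R / gam z ^+ n \in Aint.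
Proof.
move=> p_pr prim_z tot_k; have Zp := prime_power_div_1_sub_prim p_pr prim_z.
have nz : z != 0 by rewrite (prim_root_eq0 prim_z) -lt0n (prim_order_gt0 prim_z).
rewrite gam_sqr // exprMn invfM -exprM -tot_k mulrCA rpredM //.
by rewrite -exprVn rpredX // invrN invrK rpredN (Aint_prim_root prim_z).
Qed.

(** [gam z = |1 - z|^2] and [4 - gam z = |1 + z|^2]; neither vanishes, as [z] has order above 2. *)
Lemma gam_bounds (k : nat) (z : algC) :
  (2 < k)%N -> k.-primitive_root z -> 0 < gam z < 4.
Proof.
move=> k_gt2 prim_z; have k_gt0 := prim_order_gt0 prim_z.
have nz : z != 0 by rewrite (prim_root_eq0 prim_z) -lt0n.
have zn : `|z| = 1.
  by apply/eqP; rewrite -(@pexpr_eq1 _ _ k) // -normrX (prim_expr_order prim_z) normr1.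
have zJ : z^-1 = z^* by rewrite invC_norm zn expr1n invr1 mul1r.
have pos (x : algC) : x^* = x^-1 -> x != 0 -> x != 1 -> 0 < (1 - x) * (1 - x^-1).
  move=> xJ nzx x1; rewrite -xJ (_ : 1 - x^* = (1 - x)^*) ; last by rewrite rmorphB rmorph1.
  by rewrite -normCK exprn_gt0 // normr_gt0 subr_eq0 eq_sym.
rewrite gamE // pos ?(prim_neq1 _ prim_z) ?(ltnW k_gt2) //=.
rewrite -subr_gt0 (_ : 4 - _ = (1 - - z) * (1 - (- z)^-1)); last first.
  by rewrite invrN; field.
apply: pos; rewrite ?oppr_eq0 ?rmorphN /= ?invrN ?zJ //.
apply/eqP => z1; have : z ^+ 2 == 1 by rewrite -sqrrN z1 expr1n.
by rewrite -(prim_order_dvd prim_z) gtnNdvd.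
Qed.

Lemma rootCN1_norm (k : nat) : (0 < k)%N -> `|k.-root (-1) : algC| = 1.
Proof.
by move=> k_gt0; apply/eqP; rewrite -(@pexpr_eq1 _ _ k) // -normrX rootCK // normrN1.
Qed.

Lemma rootCN1_conj (k : nat) : (0 < k)%N -> (k.-root (-1) : algC)^* = (k.-root (-1))^-1.
Proof. by move=> k_gt0; rewrite invC_norm rootCN1_norm // expr1n invr1 mul1r. Qed.

Lemma rootCN1_neq0 (k : nat) : (0 < k)%N -> (k.-root (-1) : algC) != 0.
Proof. by move=> k_gt0; rewrite rootC_eq0 // oppr_eq0 oner_eq0. Qed.

Lemma gam_two_cos (k : nat) :
  (0 < k)%N -> gam (k.-root (-1) ^+ 2) = 4 - two_cos_pi_div k ^+ 2.
Proof.
move=> k_gt0; rewrite /gam /two_cos_pi_div rootCN1_conj //.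
by have := rootCN1_neq0 k_gt0; set z := k.-root _ => nz; field.
Qed.

Lemma prim_root_rootCN1_sqr (k : nat) :
  (1 < k)%N -> k.-primitive_root ((k.-root (-1) : algC) ^+ 2).
Proof.
move=> k_gt1; have := exp_prim_root (prim_root_rootCN1 k_gt1) 2.
by rewrite (gcdn_idPl (dvdn_mulr k (dvdnn 2))) mulKn.
Qed.

(** [z^3] and [z^5] have real part at most that of [z] when they, too, are [k]-th roots of -1, as
    all odd powers are. With [C = z + z^-1] this reads [C (C^2 - 4) <= 0] and
    [C (1 - C^2) (4 - C^2) <= 0]; since [C^2 < 4] and [C] is not 0, the first excludes [C < 0] and
    the second [0 < C < 1]. *)
Lemma two_cos_ge1 (k : nat) : (2 < k)%N -> 1 <= two_cos_pi_div k < 2.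
Proof.
move=> k_gt2; have k_gt0 : (0 < k)%N by apply: leq_trans k_gt2.
set c := two_cos_pi_div k; set z := k.-root (-1) : algC.
have zJ : z^* = z^-1 := rootCN1_conj k_gt0; have nz := rootCN1_neq0 k_gt0.
have Dc : c = z + z^-1 by rewrite -zJ.
have c_max (j : nat) : odd j -> z ^+ j + (z ^+ j)^-1 <= c.
  move=> odd_j; have {odd_j} zjk : (z ^+ j) ^+ k = -1.
    by rewrite exprAC rootCK // -signr_odd odd_j expr1.
  have le_Re (y : algC) : y ^+ k = -1 -> 'Re y <= 'Re z.
    move=> yk; have /orP[/rootC_Re_max|Iy] := real_leVge (real0 algC) (Creal_Im y).
      exact.
    by rewrite -Re_conj rootC_Re_max ?Im_conj ?oppr_ge0 // -rmorphXn yk rmorphN1.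
  have := le_Re _ zjk; rewrite -(ler_pM2l (ltr0n _ 2)).
  have DRe y : 2 * 'Re y = y + y^* by rewrite ReE mulrC divfK ?pnatr_eq0.
  by rewrite !DRe rmorphXn /= zJ exprVn Dc.
have cR : c \is Creal by rewrite CrealE rmorphD /= conjCK addrC.
pose C : algR := in_algR cR.
have C3 : C ^+ 3 - 3 * C <= C.
  have := c_max 3%N isT; rewrite (_ : _ + _ = c ^+ 3 - 3 * c) // Dc; field; exact: nz.
have C5 : C ^+ 5 - 5 * C ^+ 3 + 5 * C <= C.
  have := c_max 5%N isT; rewrite (_ : _ + _ = c ^+ 5 - 5 * c ^+ 3 + 5 * c) // Dc; field; exact: nz.
have C2 : C ^+ 2 < 4.
  have /andP[] := gam_bounds k_gt2 (prim_root_rootCN1_sqr (ltnW k_gt2)).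
  by rewrite gam_two_cos // subr_gt0.
have nC : C != 0.
  apply/eqP => /(congr1 val) /= c0; move: Dc; rewrite c0 => /eqP.
  rewrite eq_sym addr_eq0 => /eqP zN.
  have z2 : z ^+ 2 = -1 by rewrite expr2 {1}zN mulNr mulVf.
  have := prim_order_dvd (prim_root_rootCN1_sqr (ltnW k_gt2)) 2.
  by rewrite z2 sqrrN expr1n eqxx gtnNdvd.
have C_ge0 : 0 <= C.
  rewrite leNgt; apply/negP => C_lt0.
  have : 0 < C * (C ^+ 2 - 4) by rewrite nmulr_rgt0 // subr_lt0.
  by lra.
have C_gt0 : 0 < C by rewrite lt_neqAle eq_sym nC.
apply/andP; split.
  rewrite -[_ <= _]/(1 <= C) leNgt; apply/negP => C1.
  have : 0 < (C * (1 - C ^+ 2)) * (4 - C ^+ 2).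
    by rewrite !mulr_gt0 // subr_gt0 // expr_lt1.
  by lra.
rewrite -[_ < _]/(C < 2) ltNge; apply/negP => C_ge2.
by have := ler_pM (ler0n _ 2) (ler0n _ 2) C_ge2 C_ge2; lra.
Qed.

(** Since [-2 = z^k - 1] is [z - 1] times a sum of [k] numbers of modulus 1,
    [4 <= k^2 |z - 1|^2 = k^2 (2 - c)]. The other factor of [4 - c^2] is [2 + c >= 3], which gives
    12. *)
Lemma gam_ge (k : nat) : (2 < k)%N -> 12 / k%:R ^+ 2 <= gam (k.-root (-1) ^+ 2).
Proof.
move=> k_gt2; have k_gt0 : (0 < k)%N by apply: leq_trans k_gt2.
have /andP[c_ge1 c_lt2] := two_cos_ge1 k_gt2.
rewrite gam_two_cos //; set c := two_cos_pi_div k in c_ge1 c_lt2 *.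
set z := k.-root (-1) : algC.
have zJ : z^* = z^-1 := rootCN1_conj k_gt0; have nz := rootCN1_neq0 k_gt0.
have zn : `|z| = 1 := rootCN1_norm k_gt0.
have le2 : 2 <= `|z - 1| * k%:R.
  have -> : 2 = `|z ^+ k - 1|.
    by rewrite rootCK // -opprD normrN ger0_norm // addr_ge0 ?ler01.
  rewrite subrX1 normrM ler_wpM2l // (le_trans (ler_norm_sum _ _ _)) //.
  under eq_bigr => i _ do rewrite normrX zn expr1n.
  by rewrite sumr_const card_ord.
have D2c : `|z - 1| ^+ 2 = 2 - c.
  by rewrite (_ : c = z + z^-1) -?zJ // normCK rmorphB /= rmorph1 zJ; field.
have le4 : 4 <= (2 - c) * k%:R ^+ 2.
  rewrite -D2c -exprMn (_ : 4 = 2 ^+ 2) ?lerXn2r ?nnegrE ?ler0n ?mulr_ge0 //.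
  by rewrite -natrX.
rewrite ler_pdivrMr ?exprn_gt0 ?ltr0n //.
rewrite (_ : 4 - c ^+ 2 = (2 + c) * (2 - c)); last by ring.
rewrite -mulrA (_ : 12 = 3 * 4); last by rewrite -natrM.
apply: ler_pM => //; rewrite ?ler0n // -lerBlDl.
by rewrite (_ : 3 - 2 = 1) // -[3]/(2 + 1)%:R natrD addrC addKr.
Qed.

Lemma prim_sum0 (n : nat) (z : algC) :
  (1 < n)%N -> n.-primitive_root z -> \sum_(i < n) z ^+ i = 0.
Proof.
move=> n_gt1 prim_z; have nz : z - 1 != 0 by rewrite subr_eq0 (prim_neq1 n_gt1).
by apply: (mulfI nz); rewrite -subrX1 (prim_expr_order prim_z) subrr mulr0.
Qed.

Lemma gam_prim3 (z : algC) : 3.-primitive_root z -> gam z = 3.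
Proof.
move=> prim_z; have nz : z != 0 by rewrite (prim_root_eq0 prim_z).
have := prim_sum0 (isT : 1 < 3)%N prim_z; rewrite !big_ord_recl big_ord0 /bump /= => e.
apply: (mulfI nz); rewrite -[RHS]subr0 -e /gam; by field.
Qed.

Lemma gam_prim4 (z : algC) : 4.-primitive_root z -> gam z = 2.
Proof.
move=> prim_z; have nz : z != 0 by rewrite (prim_root_eq0 prim_z).
have z2 : z ^+ 2 + 1 = 0.
  apply: (mulfI (_ : z - 1 != 0)); first by rewrite subr_eq0 (prim_neq1 _ prim_z).
  apply: (mulfI (_ : z + 1 != 0)); last first.
    rewrite !mulr0 (_ : _ * _ = z ^+ 4 - 1); last by ring.
    by rewrite (prim_expr_order prim_z) subrr.
  rewrite addr_eq0; apply/eqP => zN; have := prim_order_dvd prim_z 2.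
  by rewrite zN sqrrN expr1n eqxx.
apply: (mulfI nz); rewrite -[RHS]subr0 -z2 /gam; by field.
Qed.

(** For a prime order [p], the sum of all powers of [z], divided by [z^((p - 1) / 2)], is up to sign
    a polynomial in [gam z]; this is the equation here and for 7 and 11. *)
Lemma gam_prim5 (z : algC) : 5.-primitive_root z -> gam z ^+ 2 - 5 * gam z + 5 = 0.
Proof.
move=> prim_z; have nz : z != 0 by rewrite (prim_root_eq0 prim_z).
have := prim_sum0 (isT : 1 < 5)%N prim_z; rewrite !big_ord_recl big_ord0 /bump /= => e.
apply: (mulfI (expf_neq0 2 nz)); rewrite mulr0 -e /gam; by field.
Qed.

Lemma gam_prim7 (z : algC) :
  7.-primitive_root z -> gam z ^+ 3 - 7 * gam z ^+ 2 + 14 * gam z - 7 = 0.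
Proof.
move=> prim_z; have nz : z != 0 by rewrite (prim_root_eq0 prim_z).
have := prim_sum0 (isT : 1 < 7)%N prim_z; rewrite !big_ord_recl big_ord0 /bump /= => e.
apply: (mulfI (expf_neq0 3 nz)); rewrite mulr0 -[RHS]oppr0 -e /gam; by field.
Qed.

Lemma gam_prim11 (z : algC) : 11.-primitive_root z ->
  gam z ^+ 5 - 11 * gam z ^+ 4 + 44 * gam z ^+ 3 - 77 * gam z ^+ 2 + 55 * gam z - 11 = 0.
Proof.
move=> prim_z; have nz : z != 0 by rewrite (prim_root_eq0 prim_z).
have := prim_sum0 (isT : 1 < 11)%N prim_z; rewrite !big_ord_recl big_ord0 /bump /= => e.
apply: (mulfI (expf_neq0 5 nz)); rewrite mulr0 -[RHS]oppr0 -e /gam; by field.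
Qed.

(** * Bounding a product of linear factors on a grid *)

Section GridBound.

Variable R : realFieldType.

(** Grid checks are evaluated by [vm_compute] on binary integers, and [ZtoR] carries the outcome to
    [R]. *)
Definition ZtoR (z : Z) : R := (int_of_Z z)%:~R.

Lemma ZtoRD a b : ZtoR (Z.add a b) = ZtoR a + ZtoR b.
Proof. by rewrite /ZtoR -rmorphD; congr _%:~R; lia. Qed.

Lemma ZtoRM a b : ZtoR (Z.mul a b) = ZtoR a * ZtoR b.
Proof. by rewrite /ZtoR -rmorphM; congr _%:~R; lia. Qed.

Lemma ZtoR_le a b : Z.leb a b -> ZtoR a <= ZtoR b.
Proof. by rewrite /ZtoR ler_int; lia. Qed.

Lemma ZtoR_abs a : ZtoR (Z.abs a) = `|ZtoR a|.
Proof. by rewrite /ZtoR -intr_norm; congr _%:~R; lia. Qed.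

Variant signed_nat := SgnNat of bool & nat.
Definition Z_of_signed (c : signed_nat) : Z :=
  let: SgnNat s n := c in if s then Z.opp (Z.of_nat n) else Z.of_nat n.
Definition R_of_signed (c : signed_nat) : R :=
  let: SgnNat s n := c in if s then - n%:R else n%:R.

Lemma ZtoR_signed c : ZtoR (Z_of_signed c) = R_of_signed c.
Proof.
case: c => -[] n; rewrite /ZtoR /=; last by rewrite (_ : int_of_Z _ = n) //; lia.
by rewrite -[n%:R]/(n%:Z%:~R) -rmorphN; congr _%:~R; lia.
Qed.

(* [(c1, c2, e)] stands for a factor [|x + c| ^+ e] with [c1 <= c <= c2]. *)
Definition factor_data := (signed_nat * signed_nat * nat)%type.

(** Interval arithmetic: for [x] in [[a, b]] the number [x + c] lies between [a + c1] and [b + c2],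
    so its absolute value is at most that of one of these ends. *)
Definition factor_bound (a b : Z) (f : factor_data) : Z :=
  ssrnat.iter f.2 (Z.mul (Z.max (Z.abs (Z.add a (Z_of_signed f.1.1)))
                                (Z.abs (Z.add b (Z_of_signed f.1.2))))) 1%Z.

Definition cell_bound (a b : Z) (fs : seq factor_data) : Z :=
  foldr (fun f z => Z.mul (factor_bound a b f) z) 1%Z fs.

Fixpoint grid_bound (n : nat) (a step B : Z) (fs : seq factor_data) : bool :=
  if n is n'.+1 then
    Z.leb (cell_bound a (Z.add a step) fs) B && grid_bound n' (Z.add a step) step B fs
  else true.

Fixpoint factors_within (cs : seq R) (fs : seq factor_data) : Prop :=
  match cs, fs with
  | c :: cs', f :: fs' =>
      [/\ R_of_signed f.1.1 <= c, c <= R_of_signed f.1.2 & factors_within cs' fs']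
  | nil, nil => True
  | _, _ => False
  end.

Lemma factor_boundP a b f (x c : R) :
  ZtoR a <= x <= ZtoR b -> R_of_signed f.1.1 <= c -> c <= R_of_signed f.1.2 ->
  `|x + c| ^+ f.2 <= ZtoR (factor_bound a b f).
Proof.
case: f => [[c1 c2] e] /= /andP[ax xb] lc cc; rewrite /factor_bound /=.
elim: e => [|e IHe] /=; first by rewrite expr0.
rewrite exprS ZtoRM ler_pM ?exprn_ge0 //.
set M := Z.max _ _.
have le1 : ZtoR (Z.abs (Z.add a (Z_of_signed c1))) <= ZtoR M by apply: ZtoR_le; lia.
have le2 : ZtoR (Z.abs (Z.add b (Z_of_signed c2))) <= ZtoR M by apply: ZtoR_le; lia.
move: le1 le2; rewrite !ZtoR_abs !ZtoRD !ZtoR_signed => le1 le2.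
rewrite ler_norml lerNl (le_trans _ le1) /=; last first.
  by rewrite -normrN (le_trans _ (ler_norm _)) // lerN2 lerD.
by rewrite (le_trans _ le2) // (le_trans _ (ler_norm _)) // lerD.
Qed.

Lemma cell_boundP a b (fs : seq factor_data) (cs : seq R) (x : R) :
  factors_within cs fs -> ZtoR a <= x <= ZtoR b ->
  \prod_(p <- zip cs [seq f.2 | f <- fs]) `|x + p.1| ^+ p.2 <= ZtoR (cell_bound a b fs).
Proof.
elim: fs cs => [|f fs IHf] [|c cs] //= => [_ _|[c1 c2 fs_in] xab]; first by rewrite big_nil.
rewrite big_cons ZtoRM ler_pM ?exprn_ge0 ?IHf ?factor_boundP //.
by apply: prodr_ge0 => i _; rewrite exprn_ge0.
Qed.

Lemma grid_boundP n a step B (fs : seq factor_data) (cs : seq R) (x : R) :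
  grid_bound n.+1 a step B fs -> factors_within cs fs ->
  ZtoR a <= x <= ZtoR a + n.+1%:R * ZtoR step ->
  \prod_(p <- zip cs [seq f.2 | f <- fs]) `|x + p.1| ^+ p.2 <= ZtoR B.
Proof.
elim: n a => [|n IHn] a /andP[cell grid] fs_in /andP[ax xn].
  apply: le_trans (ZtoR_le cell); apply: cell_boundP => //.
  by rewrite ax ZtoRD -[ZtoR step]mul1r.
have [xa|xa] := leP x (ZtoR a + ZtoR step).
  by apply: le_trans (ZtoR_le cell); apply: cell_boundP; rewrite ?ax ?ZtoRD.
apply: (IHn (Z.add a step)) => //; rewrite ZtoRD (ltW xa) /=.
by move: xn; rewrite -(natr1 n.+1); lra.
Qed.

Lemma ZtoR_n n : ZtoR (Z.of_nat n) = n%:R.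
Proof. exact: ZtoR_signed (SgnNat false n). Qed.

Lemma ZtoRX k : ZtoR (ssrnat.iter k (Z.mul 10%Z) 1%Z) = 10 ^+ k.
Proof. by elim: k => [|k IHk]; rewrite // iterS ZtoRM IHk exprS. Qed.

(* The constants and the variable are scaled by [10 ^ d] in the grid data. *)
Lemma grid_prod_le (d n step u j : nat) (fs : seq factor_data) (cs : seq R) (x : R) :
  grid_bound n.+1 0%Z (Z.of_nat step) (Z.mul (Z.of_nat u) (ssrnat.iter j (Z.mul 10%Z) 1%Z)) fs ->
  factors_within [seq 10 ^+ d * c | c <- cs] fs ->
  0 <= x -> 10 ^+ d * x <= n.+1%:R * step%:R ->
  \prod_(p <- zip cs [seq f.2 | f <- fs]) `|x + p.1| ^+ p.2
    <= u%:R * 10 ^+ j / 10 ^+ (d * sumn [seq f.2 | f <- fs]).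
Proof.
move=> grid fs_in x_ge0 xn; have D_gt0 : 0 < 10 ^+ d :> R by rewrite exprn_gt0.
rewrite ler_pdivlMr ?exprn_gt0 //.
have := @grid_boundP n 0%Z _ _ _ _ (10 ^+ d * x) grid fs_in; rewrite ZtoRM ZtoRX !ZtoR_n.
rewrite (_ : ZtoR 0%Z = 0) // add0r xn (mulr_ge0 (ltW D_gt0)) // => /(_ isT).
apply: le_trans; rewrite exprM; move: (10 ^+ d) D_gt0 fs_in => D D_gt0.
elim: fs cs {grid} => [|f fs IHf] [|c cs] //= => [_|[_ _ /IHf le]].
  by rewrite !big_nil mul1r expr0.
rewrite !big_cons exprD mulrACA ler_pM ?mulr_ge0 ?exprn_ge0 ?(ltW D_gt0) //.
  by apply: prodr_ge0 => p _; rewrite exprn_ge0.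
by rewrite -mulrDr normrM exprMn (gtr0_norm D_gt0) mulrC.
Qed.

(** The grid yields the constant [u * 10^j], up to scaling, over [n + 1] cells. It need only be
    compared with the monomial at the left ends [g0] and [h0] of the root intervals, which are so
    narrow that little is lost. *)
Lemma grid_prod_le_monomial n step u j (fs : seq factor_data) (cs : seq R) (x B g g0 h h0 : R) a b :
  grid_bound n.+1 0%Z (Z.of_nat step) (Z.mul (Z.of_nat u) (ssrnat.iter j (Z.mul 10%Z) 1%Z)) fs ->
  factors_within [seq 10 ^+ 4 * c | c <- cs] fs ->
  0 <= x -> 10 ^+ 4 * x <= n.+1%:R * step%:R -> 0 <= B -> 0 <= g0 -> g0 <= g -> 0 <= h0 -> h0 <= h ->
  u%:R * 10 ^+ j / 10 ^+ (4 * sumn [seq f.2 | f <- fs]) <= B * g0 ^+ a * h0 ^+ b ->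
  \prod_(p <- zip cs [seq f.2 | f <- fs]) `|x + p.1| ^+ p.2 <= B * g ^+ a * h ^+ b.
Proof.
move=> grid fs_in x_ge0 xn B_ge0 g0_ge0 gg h0_ge0 hh num.
apply: le_trans (grid_prod_le grid fs_in x_ge0 xn) (le_trans num _).
apply: ler_pM; rewrite ?mulr_ge0 ?exprn_ge0 //; last first.
  by rewrite lerXn2r ?nnegrE ?(le_trans h0_ge0).
by rewrite ler_wpM2l // lerXn2r ?nnegrE ?(le_trans g0_ge0).
Qed.

Lemma grid_prod_le_monomial1 n step u j (fs : seq factor_data) (cs : seq R) (x B h h0 : R) b :
  grid_bound n.+1 0%Z (Z.of_nat step) (Z.mul (Z.of_nat u) (ssrnat.iter j (Z.mul 10%Z) 1%Z)) fs ->
  factors_within [seq 10 ^+ 4 * c | c <- cs] fs ->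
  0 <= x -> 10 ^+ 4 * x <= n.+1%:R * step%:R -> 0 <= B -> 0 <= h0 -> h0 <= h ->
  u%:R * 10 ^+ j / 10 ^+ (4 * sumn [seq f.2 | f <- fs]) <= B * h0 ^+ b ->
  \prod_(p <- zip cs [seq f.2 | f <- fs]) `|x + p.1| ^+ p.2 <= B * h ^+ b.
Proof.
move=> grid fs_in x_ge0 xn B_ge0 h0_ge0 hh num.
have := @grid_prod_le_monomial n step u j fs cs x B 1 1 h h0 0 b grid fs_in x_ge0 xn B_ge0.
by rewrite expr0 mulr1; apply.
Qed.

End GridBound.

(* Only small numerals occur, because those of an abstract ring are unary. *)
Lemma root5_cases (R : realFieldType) (y : R) : y ^+ 2 - 5 * y + 5 = 0 ->
  (138 / 100 + 19 / 10 ^+ 4) <= y <= (138 / 100 + 20 / 10 ^+ 4)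
  \/ (361 / 100 + 80 / 10 ^+ 4) <= y <= (361 / 100 + 81 / 10 ^+ 4).
Proof.
move=> y5; have [y_le|y_gt] := leP y (138 / 100 + 20 / 10 ^+ 4).
  left; apply/andP; split=> //; rewrite leNgt; apply/negP => y_lt.
  have : 0 < ((138 / 100 + 19 / 10 ^+ 4) - y) * ((361 / 100 + 81 / 10 ^+ 4) - y)
    by apply: mulr_gt0; lra.
  by lra.
right; apply/andP; split; rewrite leNgt; apply/negP => y_lt.
  have : 0 < (y - (138 / 100 + 20 / 10 ^+ 4)) * ((361 / 100 + 80 / 10 ^+ 4) - y)
    by apply: mulr_gt0; lra.
  by lra.
have : 0 < (y - (138 / 100 + 19 / 10 ^+ 4)) * (y - (361 / 100 + 81 / 10 ^+ 4))
  by apply: mulr_gt0; lra.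
by lra.
Qed.

(* With [f] the cubic, [f y - f a = (y - a) * (y ^ 2 + (a - 7) y + (a ^ 2 - 7 a + 14))],
   applied with [a] the end point of a gap between the root intervals. *)
Lemma root7_cases (R : realFieldType) (y : R) :
  0 < y < 4 -> y ^+ 3 - 7 * y ^+ 2 + 14 * y - 7 = 0 ->
  [\/ (75 / 100 + 30 / 10 ^+ 4) <= y <= (75 / 100 + 31 / 10 ^+ 4),
      (244 / 100 + 50 / 10 ^+ 4) <= y <= (244 / 100 + 51 / 10 ^+ 4)
     | (380 / 100 + 19 / 10 ^+ 4) <= y <= (380 / 100 + 20 / 10 ^+ 4)].
Proof.
move=> /andP[y_gt0 y_lt4] y7; pose q (a : R) := y ^+ 2 + (a - 7) * y + (a ^+ 2 - 7 * a + 14).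
have fq a : (y - a) * q a = - (a ^+ 3 - 7 * a ^+ 2 + 14 * a - 7).
  by rewrite -[RHS]add0r -y7 /q; ring.
have [y1|y1] := leP y (75 / 100 + 31 / 10 ^+ 4).
  constructor 1; apply/andP; split=> //; rewrite leNgt; apply/negP => y_lt.
  have q_gt0 : 0 < q (75 / 100 + 30 / 10 ^+ 4) by rewrite /q; have := sqr_ge0 y; lra.
  have := fq (75 / 100 + 30 / 10 ^+ 4).
  have : 0 < ((75 / 100 + 30 / 10 ^+ 4) - y) * q (75 / 100 + 30 / 10 ^+ 4).
    by apply: mulr_gt0 => //; lra.
  by lra.
have [y2|y2] := leP y (244 / 100 + 51 / 10 ^+ 4).
  constructor 2; apply/andP; split=> //; rewrite leNgt; apply/negP => y_lt.
  have q_lt0 : 0 < - q (244 / 100 + 50 / 10 ^+ 4).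
    have : 0 < (y - (75 / 100 + 31 / 10 ^+ 4)) * ((244 / 100 + 50 / 10 ^+ 4) - y)
      by apply: mulr_gt0; lra.
    by rewrite /q; lra.
  have := fq (244 / 100 + 50 / 10 ^+ 4).
  have : 0 < ((244 / 100 + 50 / 10 ^+ 4) - y) * - q (244 / 100 + 50 / 10 ^+ 4)
    by apply: mulr_gt0 => //; lra.
  by lra.
constructor 3; apply/andP; split; rewrite leNgt; apply/negP => y_lt.
  have q_lt0 : 0 < - q (244 / 100 + 51 / 10 ^+ 4).
    have : 0 < (y - (244 / 100 + 51 / 10 ^+ 4)) * ((380 / 100 + 19 / 10 ^+ 4) - y)
      by apply: mulr_gt0; lra.
    by rewrite /q; lra.
  have := fq (244 / 100 + 51 / 10 ^+ 4).
  have : 0 < (y - (244 / 100 + 51 / 10 ^+ 4)) * - q (244 / 100 + 51 / 10 ^+ 4)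
    by apply: mulr_gt0 => //; lra.
  by lra.
have q_gt0 : 0 < q (380 / 100 + 20 / 10 ^+ 4).
  have : 0 < (y - (380 / 100 + 20 / 10 ^+ 4)) * y by apply: mulr_gt0; lra.
  by rewrite /q; lra.
have := fq (380 / 100 + 20 / 10 ^+ 4).
have : 0 < (y - (380 / 100 + 20 / 10 ^+ 4)) * q (380 / 100 + 20 / 10 ^+ 4)
  by apply: mulr_gt0 => //; lra.
by lra.
Qed.

(** Passing from [r0] to [r] multiplies the left side by [(B^n Q)^(r - r0) <= 1], so a single
    numerical check covers all larger degrees. *)
Lemma geometric_lt1 (R : realFieldType) (K B Q : R) (n r0 r : nat) :
  0 <= K -> 0 <= B -> 0 <= Q -> B ^+ n * Q <= 1 -> (0 < n * r0)%N -> (r0 <= r)%N ->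
  K * B ^+ (n * r0).-1 * Q ^+ r0 < 1 -> K * B ^+ (n * r).-1 * Q ^+ r < 1.
Proof.
move=> K_ge0 B_ge0 Q_ge0 BQ nr0 r0r; apply: le_lt_trans.
rewrite -(subnK r0r) addnC mulnDr -(prednK nr0) addSn /= !exprD exprM.
set t := (r - r0)%N; rewrite (_ : _ * _ * _ = K * B ^+ (n * r0).-1 * Q ^+ r0 * (B ^+ n * Q) ^+ t).
  by rewrite ler_piMr ?mulr_ge0 ?exprn_ge0 // exprn_ile1 // mulr_ge0 ?exprn_ge0.
by rewrite [in RHS]exprMn; ring.
Qed.

(* In this lemma and the next ones, [x] is a conjugate of [u ^ 2].  For each possible
   root [h], the interval of [x] is cut into equal cells, whose length is the second
   numeral in units of [10 ^ -4], and on each cell every factor is bounded separately. *)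
Lemma factors_le_3_5 (R : realFieldType) (x h : R) :
  h ^+ 2 - 5 * h + 5 = 0 -> 0 < x -> 4 * x < 3 * h ->
  \prod_(p <- zip [:: 0; - 1; 1 - h] [:: 1; 1; 1]%N) `|x + p.1| ^+ p.2
    <= 3 / 100 * h ^+ 3.
Proof.
move=> h5 x0 x2; case: (root5_cases h5) => {h5}.
- move=> /andP[h1 h2].
  apply: (@grid_prod_le_monomial1 R 29 346 78979 6
      [:: (SgnNat false 0, SgnNat false 0, 1%N);
       (SgnNat true 10000, SgnNat true 10000, 1%N);
       (SgnNat true 3822, SgnNat true 3817, 1%N)]
      [:: 0; - 1; 1 - h] x _ _ (138 / 100 + 19 / 10 ^+ 4));
    [by vm_compute | cbv [factors_within R_of_signed map fst snd]; repeat split;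
      first [(clear; lra) | (clear - h1 h2; lra)]
    | exact: ltW | clear - x2 h2; lra | clear; lra | clear; lra | exact: h1
    | cbn [sumn map snd foldr]; clear; lra].
- move=> /andP[h1 h2].
  apply: (@grid_prod_le_monomial1 R 29 905 14163 8
      [:: (SgnNat false 0, SgnNat false 0, 1%N);
       (SgnNat true 10000, SgnNat true 10000, 1%N);
       (SgnNat true 26183, SgnNat true 26178, 1%N)]
      [:: 0; - 1; 1 - h] x _ _ (361 / 100 + 80 / 10 ^+ 4));
    [by vm_compute | cbv [factors_within R_of_signed map fst snd]; repeat split;
      first [(clear; lra) | (clear - h1 h2; lra)]
    | exact: ltW | clear - x2 h2; lra | clear; lra | clear; lra | exact: h1
    | cbn [sumn map snd foldr]; clear; lra].
Qed.

Lemma factors_le_5_5 (R : realFieldType) (x h : R) :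
  h ^+ 2 - 5 * h + 5 = 0 -> 0 < x -> 4 * x < h * h ->
  \prod_(p <- zip [:: 0; 1 - h] [:: 1; 1]%N) `|x + p.1| ^+ p.2
    <= 3 / 200 * h ^+ 4.
Proof.
move=> h5 x0 x2; case: (root5_cases h5) => {h5}.
- move=> /andP[h1 h2].
  have hh : h * h <= (138 / 100 + 20 / 10 ^+ 4) * (138 / 100 + 20 / 10 ^+ 4)
    by apply: ler_pM; clear - h1 h2; lra.
  apply: (@grid_prod_le_monomial1 R 9 478 46032 2
      [:: (SgnNat false 0, SgnNat false 0, 1%N);
       (SgnNat true 3822, SgnNat true 3817, 1%N)]
      [:: 0; 1 - h] x _ _ (138 / 100 + 19 / 10 ^+ 4));
    [by vm_compute | cbv [factors_within R_of_signed map fst snd]; repeat split;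
      first [(clear; lra) | (clear - h1 h2; lra)]
    | exact: ltW | clear - x2 hh; lra | clear; lra | clear; lra | exact: h1
    | cbn [sumn map snd foldr]; clear; lra].
- move=> /andP[h1 h2].
  have hh : h * h <= (361 / 100 + 81 / 10 ^+ 4) * (361 / 100 + 81 / 10 ^+ 4)
    by apply: ler_pM; clear - h1 h2; lra.
  apply: (@grid_prod_le_monomial1 R 9 3273 21445 4
      [:: (SgnNat false 0, SgnNat false 0, 1%N);
       (SgnNat true 26183, SgnNat true 26178, 1%N)]
      [:: 0; 1 - h] x _ _ (361 / 100 + 80 / 10 ^+ 4));
    [by vm_compute | cbv [factors_within R_of_signed map fst snd]; repeat split;
      first [(clear; lra) | (clear - h1 h2; lra)]
    | exact: ltW | clear - x2 hh; lra | clear; lra | clear; lra | exact: h1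
    | cbn [sumn map snd foldr]; clear; lra].
Qed.

(** The last factor vanishes at [h^2 - 4 h + 3], near 0.555, -0.802 and 2.247 for the three roots
    [h]. For the smallest and the largest root this lies inside the range of [x], which ends at
    [3 h / 4], and supplements the zeros 0, 1, [h - 1]. *)
Lemma factors_le_3_7 (R : realFieldType) (x h : R) :
  0 < h < 4 -> h ^+ 3 - 7 * h ^+ 2 + 14 * h - 7 = 0 -> 0 < x -> 4 * x < 3 * h ->
  \prod_(p <- zip [:: 0; - 1; 1 - h; - 3 + 4 * h - h ^+ 2] [:: 2; 4; 4; 1]%N) `|x + p.1| ^+ p.2
    <= 1 / 400 * h ^+ 5.
Proof.
move=> h04 h5 x0 x2; case: (root7_cases h04 h5) => {h04 h5}.
- move=> /andP[h1 h2].
  (* [hq] and [hq'] bound [h^2] above and below by linear functions of [h], which encloses the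
     quadratic constant of the last factor. *)
  have hq : 0 <= (h - (75 / 100 + 30 / 10 ^+ 4)) * ((75 / 100 + 31 / 10 ^+ 4) - h)
    by apply: mulr_ge0; clear - h1 h2; lra.
  have hq' := sqr_ge0 (h - (75 / 100 + 30 / 10 ^+ 4)).
  apply: (@grid_prod_le_monomial1 R 199 29 60019 36
      [:: (SgnNat false 0, SgnNat false 0, 2%N);
       (SgnNat true 10000, SgnNat true 10000, 4%N);
       (SgnNat false 2467, SgnNat false 2472, 4%N);
       (SgnNat true 5553, SgnNat true 5545, 1%N)]
      [:: 0; - 1; 1 - h; - 3 + 4 * h - h ^+ 2] x _ _ (75 / 100 + 30 / 10 ^+ 4));
    [by vm_compute | cbv [factors_within R_of_signed map fst snd]; repeat split;
      first [(clear; lra) | (clear - h1 h2; lra) | (clear - h1 h2 hq hq'; lra)]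
    | exact: ltW | clear - x2 h2; lra | clear; lra | clear; lra | exact: h1
    | cbn [sumn map snd foldr]; clear; lra].
- move=> /andP[h1 h2].
  have hq : 0 <= (h - (244 / 100 + 50 / 10 ^+ 4)) * ((244 / 100 + 51 / 10 ^+ 4) - h)
    by apply: mulr_ge0; clear - h1 h2; lra.
  have hq' := sqr_ge0 (h - (244 / 100 + 50 / 10 ^+ 4)).
  apply: (@grid_prod_le_monomial1 R 9 1834 17735 39
      [:: (SgnNat false 0, SgnNat false 0, 2%N);
       (SgnNat true 10000, SgnNat true 10000, 4%N);
       (SgnNat true 14453, SgnNat true 14448, 4%N);
       (SgnNat false 8016, SgnNat false 8022, 1%N)]
      [:: 0; - 1; 1 - h; - 3 + 4 * h - h ^+ 2] x _ _ (244 / 100 + 50 / 10 ^+ 4));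
    [by vm_compute | cbv [factors_within R_of_signed map fst snd]; repeat split;
      first [(clear; lra) | (clear - h1 h2; lra) | (clear - h1 h2 hq hq'; lra)]
    | exact: ltW | clear - x2 h2; lra | clear; lra | clear; lra | exact: h1
    | cbn [sumn map snd foldr]; clear; lra].
- move=> /andP[h1 h2].
  have hq : 0 <= (h - (380 / 100 + 19 / 10 ^+ 4)) * ((380 / 100 + 20 / 10 ^+ 4) - h)
    by apply: mulr_ge0; clear - h1 h2; lra.
  have hq' := sqr_ge0 (h - (380 / 100 + 19 / 10 ^+ 4)).
  apply: (@grid_prod_le_monomial1 R 149 191 19417 40
      [:: (SgnNat false 0, SgnNat false 0, 2%N);
       (SgnNat true 10000, SgnNat true 10000, 4%N);
       (SgnNat true 28022, SgnNat true 28017, 4%N);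
       (SgnNat true 22475, SgnNat true 22466, 1%N)]
      [:: 0; - 1; 1 - h; - 3 + 4 * h - h ^+ 2] x _ _ (380 / 100 + 19 / 10 ^+ 4));
    [by vm_compute | cbv [factors_within R_of_signed map fst snd]; repeat split;
      first [(clear; lra) | (clear - h1 h2; lra) | (clear - h1 h2 hq hq'; lra)]
    | exact: ltW | clear - x2 h2; lra | clear; lra | clear; lra | exact: h1
    | cbn [sumn map snd foldr]; clear; lra].
Qed.

Lemma factors_le_7_7 (R : realFieldType) (x h : R) :
  0 < h < 4 -> h ^+ 3 - 7 * h ^+ 2 + 14 * h - 7 = 0 -> 0 < x -> 4 * x < h * h ->
  \prod_(p <- zip [:: 0; 1 - h] [:: 2; 3]%N) `|x + p.1| ^+ p.2
    <= 1 / 100 * h ^+ 5.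
Proof.
move=> h04 h5 x0 x2; case: (root7_cases h04 h5) => {h04 h5}.
- move=> /andP[h1 h2].
  have hh : h * h <= (75 / 100 + 31 / 10 ^+ 4) * (75 / 100 + 31 / 10 ^+ 4)
    by apply: ler_pM; clear - h1 h2; lra.
  apply: (@grid_prod_le_monomial1 R 9 142 11888 13
      [:: (SgnNat false 0, SgnNat false 0, 2%N);
       (SgnNat false 2467, SgnNat false 2472, 3%N)]
      [:: 0; 1 - h] x _ _ (75 / 100 + 30 / 10 ^+ 4));
    [by vm_compute | cbv [factors_within R_of_signed map fst snd]; repeat split;
      first [(clear; lra) | (clear - h1 h2; lra)]
    | exact: ltW | clear - x2 hh; lra | clear; lra | clear; lra | exact: h1
    | cbn [sumn map snd foldr]; clear; lra].
- move=> /andP[h1 h2].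
  have hh : h * h <= (244 / 100 + 51 / 10 ^+ 4) * (244 / 100 + 51 / 10 ^+ 4)
    by apply: ler_pM; clear - h1 h2; lra.
  apply: (@grid_prod_le_monomial1 R 9 1495 35419 15
      [:: (SgnNat false 0, SgnNat false 0, 2%N);
       (SgnNat true 14453, SgnNat true 14448, 3%N)]
      [:: 0; 1 - h] x _ _ (244 / 100 + 50 / 10 ^+ 4));
    [by vm_compute | cbv [factors_within R_of_signed map fst snd]; repeat split;
      first [(clear; lra) | (clear - h1 h2; lra)]
    | exact: ltW | clear - x2 hh; lra | clear; lra | clear; lra | exact: h1
    | cbn [sumn map snd foldr]; clear; lra].
- move=> /andP[h1 h2].
  have hh : h * h <= (380 / 100 + 20 / 10 ^+ 4) * (380 / 100 + 20 / 10 ^+ 4)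
    by apply: ler_pM; clear - h1 h2; lra.
  apply: (@grid_prod_le_monomial1 R 24 1446 76750 16
      [:: (SgnNat false 0, SgnNat false 0, 2%N);
       (SgnNat true 28022, SgnNat true 28017, 3%N)]
      [:: 0; 1 - h] x _ _ (380 / 100 + 19 / 10 ^+ 4));
    [by vm_compute | cbv [factors_within R_of_signed map fst snd]; repeat split;
      first [(clear; lra) | (clear - h1 h2; lra)]
    | exact: ltW | clear - x2 hh; lra | clear; lra | clear; lra | exact: h1
    | cbn [sumn map snd foldr]; clear; lra].
Qed.

(** There are six ranges for [x], one for each pair of roots. The zero [g - 1] depends on [g] alone,
    and [5 h - h^2 - 3], near 0.198, 3.247 and 1.555, on [h] alone. *)
Lemma factors_le_5_7 (R : realFieldType) (x g h : R) :
  g ^+ 2 - 5 * g + 5 = 0 -> 0 < h < 4 -> h ^+ 3 - 7 * h ^+ 2 + 14 * h - 7 = 0 ->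
  0 < x -> 4 * x < g * h ->
  \prod_(p <- zip [:: 0; - 1; 1 - g; 3 - 5 * h + h ^+ 2] [:: 2; 4; 6; 2]%N) `|x + p.1| ^+ p.2
    <= 11 / 10 ^+ 9 * g ^+ 14 * h ^+ 5.
Proof.
move=> g5 h04 h7 x0 x2; case: (root5_cases g5) => {g5}; case: (root7_cases h04 h7) => {h04 h7}.
- move=> /andP[h1 h2] /andP[g1 g2].
  have gh : g * h <= (138 / 100 + 20 / 10 ^+ 4) * (75 / 100 + 31 / 10 ^+ 4)
    by apply: ler_pM; clear - g1 g2 h1 h2; lra.
  have hq : 0 <= (h - (75 / 100 + 30 / 10 ^+ 4)) * ((75 / 100 + 31 / 10 ^+ 4) - h)
    by apply: mulr_ge0; clear - h1 h2; lra.
  have hq' := sqr_ge0 (h - (75 / 100 + 30 / 10 ^+ 4)).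
  apply: (@grid_prod_le_monomial R 9 261 14874 45
      [:: (SgnNat false 0, SgnNat false 0, 2%N);
       (SgnNat true 10000, SgnNat true 10000, 4%N);
       (SgnNat true 3822, SgnNat true 3817, 6%N);
       (SgnNat true 1986, SgnNat true 1977, 2%N)]
      [:: 0; - 1; 1 - g; 3 - 5 * h + h ^+ 2] x _ _
      (138 / 100 + 19 / 10 ^+ 4) _ (75 / 100 + 30 / 10 ^+ 4));
    [by vm_compute | cbv [factors_within R_of_signed map fst snd]; repeat split;
      first [(clear; lra) | (clear - g1 g2; lra) | (clear - h1 h2 hq hq'; lra)]
    | exact: ltW | clear - x2 gh; lra | clear; lra | clear; lra | exact: g1 | clear; lra | exact: h1
    | cbn [sumn map snd foldr]; clear; lra].
- move=> /andP[h1 h2] /andP[g1 g2].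
  have gh : g * h <= (138 / 100 + 20 / 10 ^+ 4) * (244 / 100 + 51 / 10 ^+ 4)
    by apply: ler_pM; clear - g1 g2 h1 h2; lra.
  have hq : 0 <= (h - (244 / 100 + 50 / 10 ^+ 4)) * ((244 / 100 + 51 / 10 ^+ 4) - h)
    by apply: mulr_ge0; clear - h1 h2; lra.
  have hq' := sqr_ge0 (h - (244 / 100 + 50 / 10 ^+ 4)).
  apply: (@grid_prod_le_monomial R 24 338 76170 47
      [:: (SgnNat false 0, SgnNat false 0, 2%N);
       (SgnNat true 10000, SgnNat true 10000, 4%N);
       (SgnNat true 3822, SgnNat true 3817, 6%N);
       (SgnNat true 32472, SgnNat true 32467, 2%N)]
      [:: 0; - 1; 1 - g; 3 - 5 * h + h ^+ 2] x _ _
      (138 / 100 + 19 / 10 ^+ 4) _ (244 / 100 + 50 / 10 ^+ 4));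
    [by vm_compute | cbv [factors_within R_of_signed map fst snd]; repeat split;
      first [(clear; lra) | (clear - g1 g2; lra) | (clear - h1 h2 hq hq'; lra)]
    | exact: ltW | clear - x2 gh; lra | clear; lra | clear; lra | exact: g1 | clear; lra | exact: h1
    | cbn [sumn map snd foldr]; clear; lra].
- move=> /andP[h1 h2] /andP[g1 g2].
  have gh : g * h <= (138 / 100 + 20 / 10 ^+ 4) * (380 / 100 + 20 / 10 ^+ 4)
    by apply: ler_pM; clear - g1 g2 h1 h2; lra.
  have hq : 0 <= (h - (380 / 100 + 19 / 10 ^+ 4)) * ((380 / 100 + 20 / 10 ^+ 4) - h)
    by apply: mulr_ge0; clear - h1 h2; lra.
  have hq' := sqr_ge0 (h - (380 / 100 + 19 / 10 ^+ 4)).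
  apply: (@grid_prod_le_monomial R 49 263 79973 48
      [:: (SgnNat false 0, SgnNat false 0, 2%N);
       (SgnNat true 10000, SgnNat true 10000, 4%N);
       (SgnNat true 3822, SgnNat true 3817, 6%N);
       (SgnNat true 15553, SgnNat true 15545, 2%N)]
      [:: 0; - 1; 1 - g; 3 - 5 * h + h ^+ 2] x _ _
      (138 / 100 + 19 / 10 ^+ 4) _ (380 / 100 + 19 / 10 ^+ 4));
    [by vm_compute | cbv [factors_within R_of_signed map fst snd]; repeat split;
      first [(clear; lra) | (clear - g1 g2; lra) | (clear - h1 h2 hq hq'; lra)]
    | exact: ltW | clear - x2 gh; lra | clear; lra | clear; lra | exact: g1 | clear; lra | exact: h1
    | cbn [sumn map snd foldr]; clear; lra].
- move=> /andP[h1 h2] /andP[g1 g2].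
  have gh : g * h <= (361 / 100 + 81 / 10 ^+ 4) * (75 / 100 + 31 / 10 ^+ 4)
    by apply: ler_pM; clear - g1 g2 h1 h2; lra.
  have hq : 0 <= (h - (75 / 100 + 30 / 10 ^+ 4)) * ((75 / 100 + 31 / 10 ^+ 4) - h)
    by apply: mulr_ge0; clear - h1 h2; lra.
  have hq' := sqr_ge0 (h - (75 / 100 + 30 / 10 ^+ 4)).
  apply: (@grid_prod_le_monomial R 24 273 17173 51
      [:: (SgnNat false 0, SgnNat false 0, 2%N);
       (SgnNat true 10000, SgnNat true 10000, 4%N);
       (SgnNat true 26183, SgnNat true 26178, 6%N);
       (SgnNat true 1986, SgnNat true 1977, 2%N)]
      [:: 0; - 1; 1 - g; 3 - 5 * h + h ^+ 2] x _ _
      (361 / 100 + 80 / 10 ^+ 4) _ (75 / 100 + 30 / 10 ^+ 4));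
    [by vm_compute | cbv [factors_within R_of_signed map fst snd]; repeat split;
      first [(clear; lra) | (clear - g1 g2; lra) | (clear - h1 h2 hq hq'; lra)]
    | exact: ltW | clear - x2 gh; lra | clear; lra | clear; lra | exact: g1 | clear; lra | exact: h1
    | cbn [sumn map snd foldr]; clear; lra].
- move=> /andP[h1 h2] /andP[g1 g2].
  have gh : g * h <= (361 / 100 + 81 / 10 ^+ 4) * (244 / 100 + 51 / 10 ^+ 4)
    by apply: ler_pM; clear - g1 g2 h1 h2; lra.
  have hq : 0 <= (h - (244 / 100 + 50 / 10 ^+ 4)) * ((244 / 100 + 51 / 10 ^+ 4) - h)
    by apply: mulr_ge0; clear - h1 h2; lra.
  have hq' := sqr_ge0 (h - (244 / 100 + 50 / 10 ^+ 4)).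
  apply: (@grid_prod_le_monomial R 29 738 56554 53
      [:: (SgnNat false 0, SgnNat false 0, 2%N);
       (SgnNat true 10000, SgnNat true 10000, 4%N);
       (SgnNat true 26183, SgnNat true 26178, 6%N);
       (SgnNat true 32472, SgnNat true 32467, 2%N)]
      [:: 0; - 1; 1 - g; 3 - 5 * h + h ^+ 2] x _ _
      (361 / 100 + 80 / 10 ^+ 4) _ (244 / 100 + 50 / 10 ^+ 4));
    [by vm_compute | cbv [factors_within R_of_signed map fst snd]; repeat split;
      first [(clear; lra) | (clear - g1 g2; lra) | (clear - h1 h2 hq hq'; lra)]
    | exact: ltW | clear - x2 gh; lra | clear; lra | clear; lra | exact: g1 | clear; lra | exact: h1
    | cbn [sumn map snd foldr]; clear; lra].
- move=> /andP[h1 h2] /andP[g1 g2].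
  have gh : g * h <= (361 / 100 + 81 / 10 ^+ 4) * (380 / 100 + 20 / 10 ^+ 4)
    by apply: ler_pM; clear - g1 g2 h1 h2; lra.
  have hq : 0 <= (h - (380 / 100 + 19 / 10 ^+ 4)) * ((380 / 100 + 20 / 10 ^+ 4) - h)
    by apply: mulr_ge0; clear - h1 h2; lra.
  have hq' := sqr_ge0 (h - (380 / 100 + 19 / 10 ^+ 4)).
  apply: (@grid_prod_le_monomial R 9 3440 46068 54
      [:: (SgnNat false 0, SgnNat false 0, 2%N);
       (SgnNat true 10000, SgnNat true 10000, 4%N);
       (SgnNat true 26183, SgnNat true 26178, 6%N);
       (SgnNat true 15553, SgnNat true 15545, 2%N)]
      [:: 0; - 1; 1 - g; 3 - 5 * h + h ^+ 2] x _ _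
      (361 / 100 + 80 / 10 ^+ 4) _ (380 / 100 + 19 / 10 ^+ 4));
    [by vm_compute | cbv [factors_within R_of_signed map fst snd]; repeat split;
      first [(clear; lra) | (clear - g1 g2; lra) | (clear - h1 h2 hq hq'; lra)]
    | exact: ltW | clear - x2 gh; lra | clear; lra | clear; lra | exact: g1 | clear; lra | exact: h1
    | cbn [sumn map snd foldr]; clear; lra].
Qed.

(** Weighted AM-GM: [v] is the mean of four copies of [u] and one of [5 v - 4 u]. The difference of
    the two sides has the double root [v = u]. *)
Lemma amgm_4_1 (R : realFieldType) (u v : R) :
  0 <= u -> 0 <= v -> u ^+ 4 * (5 * v - 4 * u) <= v ^+ 5.
Proof.
move=> u_ge0 v_ge0; rewrite -subr_ge0.
rewrite (_ : _ - _ = (v - u) ^+ 2 * (v ^+ 3 + 2 * u * v ^+ 2 + 3 * u ^+ 2 * v + 4 * u ^+ 3)).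
  by rewrite mulr_ge0 ?sqr_ge0 // !addr_ge0 ?mulr_ge0 ?exprn_ge0 ?ler0n.
by ring.
Qed.

(* [x (h - x) = u] and [(h - 2 x)^2 = h^2 - 4 u], so that the weighted AM-GM
   inequality applies to four factors [u] and one factor [h^2 - 4 u]. *)
Lemma generic_factor_le (R : realFieldType) (x h : R) :
  0 < x -> x < h -> `|(x * (h - x)) ^+ 4 * (h - 2 * x) ^+ 2| <= 1 / 5 ^+ 5 * h ^+ 10.
Proof.
move=> x_gt0 xh; have u_ge0 : 0 <= x * (h - x) by rewrite mulr_ge0 ?subr_ge0 ?ltW.
rewrite ger0_norm; last by rewrite mulr_ge0 ?sqr_ge0 // exprn_ge0.
have v_ge0 : 0 <= h ^+ 2 / 5 by rewrite divr_ge0 ?sqr_ge0.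
have := amgm_4_1 u_ge0 v_ge0.
have -> : 5 * (h ^+ 2 / 5) - 4 * (x * (h - x)) = (h - 2 * x) ^+ 2 by field.
by have -> : (h ^+ 2 / 5) ^+ 5 = 1 / 5 ^+ 5 * h ^+ 10 by field.
Qed.

(** * The numerical inequality for generic indices *)

(** Both sides are multiplicative. For [p^(a + 1)] with [p >= 5] it suffices that [p^2 <= (p - 1)^3]
    and [p^(2 a) <= p^(3 a)]; the first fails for 2 and 3. *)
Lemma totient_cube_coprime6 (k : nat) : coprime k 6 -> (k ^ 2 <= totient k ^ 3)%N.
Proof.
have [m] := ubnP k; elim: m k => // m IHm k; rewrite ltnS => k_le co_k6.
have [k_le1|k_gt1] := leqP k 1.
  by case: k k_le1 co_k6 {k_le} => [|[|]].
have k_gt0 := ltnW k_gt1; have p_pr := pdiv_prime k_gt1; set p := pdiv k in p_pr.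
have [l co_pl] := pfactor_coprime p_pr k_gt0.
have : (0 < logn p k)%N by rewrite logn_gt0 mem_primes p_pr k_gt0 pdiv_dvd.
case: (logn p k) => // a _ Dk.
have p_ge5 : (4 < p)%N.
  have : coprime p 6 by apply: coprime_dvdl co_k6; apply: pdiv_dvd.
  by case: (p) p_pr => [|[|[|[|[|]]]]].
have l_gt0 : (0 < l)%N by move: k_gt0; rewrite Dk muln_gt0 => /andP[].
have l_lt : (l < m)%N.
  apply: leq_trans k_le; rewrite Dk ltn_Pmulr //.
  by rewrite -(exp1n a.+1) ltn_exp2r // prime_gt1.
have co_l6 : coprime l 6 by apply: coprime_dvdl co_k6; rewrite Dk dvdn_mulr.
rewrite Dk totient_coprime 1?coprime_sym ?coprimeXl // totient_pfactor //= !expnMn.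
apply: leq_mul; first exact: IHm.
rewrite (expnS p a) !expnMn leq_mul //; last by rewrite -!expnM leq_exp2l ?prime_gt1 // leq_mul2l orbT.
by case: (p) p_ge5 => // q q_ge; rewrite /=; nia.
Qed.

(** The power of 3 costs at most the factor [2^3 / 3^2 = 8/9] and the power of 2 at most [1/4];
    their product is [2/9]. *)
Lemma totient_cube (k : nat) : (0 < k)%N -> (2 * k ^ 2 <= 9 * totient k ^ 3)%N.
Proof.
move=> k_gt0; have [l2 co2 Dk] := pfactor_coprime (isT : prime 2) k_gt0.
have l2_gt0 : (0 < l2)%N by move: k_gt0; rewrite Dk muln_gt0 => /andP[].
have [l co3 Dl2] := pfactor_coprime (isT : prime 3) l2_gt0.
have l_gt0 : (0 < l)%N by move: l2_gt0; rewrite Dl2 muln_gt0 => /andP[].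
have co6 : coprime l 6.
  rewrite (coprimeMr l 2 3) ![coprime l _]coprime_sym co3 andbT.
  by apply: coprime_dvdr co2; rewrite Dl2 dvdn_mulr.
have le3 : (8 * l2 ^ 2 <= 9 * totient l2 ^ 3)%N.
  have := totient_cube_coprime6 co6.
  move: Dl2; case: (logn 3 l2) => [|b] ->; first by rewrite muln1; nia.
  rewrite totient_coprime 1?coprime_sym ?coprimeXl // totient_pfactor //= !expnMn.
  have : (0 < 3 ^ b)%N by rewrite expn_gt0.
  by rewrite (expnS 3 b) expnMn; move: (3 ^ b)%N (l ^ 2)%N (totient l ^ 3)%N => x y z; nia.
move: Dk; case: (logn 2 k) => [|b] ->; first by rewrite muln1; nia.
rewrite totient_coprime 1?coprime_sym ?coprimeXl // totient_pfactor //= !expnMn.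
have : (0 < 2 ^ b)%N by rewrite expn_gt0.
by rewrite (expnS 2 b) expnMn; move: (2 ^ b)%N (l2 ^ 2)%N (totient l2 ^ 3)%N le3 => x y z; nia.
Qed.

Section GenericNumerics.

Variable R : realFieldType.

(** Beyond the numerical case 21, each step multiplies the right side by 5 and [n^6] by at most
    [(22 / 21)^6 < 5]. *)
Lemma exp5_ge_sextic (n : nat) : (21 <= n)%N -> 9 * (132 / 100 * 196 ^+ 2) * n%:R ^+ 6 < 5 ^+ n.-1 :> R.
Proof.
elim: n => // n IHn; rewrite leq_eqVlt => /orP[/eqP<- /=|n_ge]; first by lra.
have {}IHn := IHn n_ge; have n_gt0 : (0 < n)%N by case: (n) n_ge.
have Yn : 5 ^+ n = 5 * 5 ^+ n.-1 :> R by rewrite -exprS prednK.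
rewrite /= Yn -(natr1 n) => {Yn}; move: IHn.
move: (5 ^+ n.-1) => Y; have : 21%:R <= n%:R :> R by rewrite ler_nat.
move: (n%:R) => x x_ge le.
apply: le_lt_trans (_ : 5 * (9 * (132 / 100 * 196 ^+ 2) * x ^+ 6) < _); last first.
  by rewrite ltr_pM2l.
rewrite [leRHS]mulrCA; apply: ler_wpM2l; first by lra.
apply: (@le_trans _ _ ((22 / 21 * x) ^+ 6)).
  by rewrite lerXn2r ?nnegrE //; lra.
by rewrite exprMn ler_wpM2r ?exprn_ge0 //; lra.
Qed.

(** This is the case of a unit [h]. From [totient k <= 2 N] follows [k^2 <= 36 N^3], hence
    [h >= 1 / (3 N^3)], and [5^(N - 1)] outgrows [N^6]. *)
Lemma generic_inequality_unit (k N : nat) (h : R) :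
  (0 < k)%N -> (21 <= N)%N -> (totient k <= 2 * N)%N -> 12 / k%:R ^+ 2 <= h ->
  132 / 100 * 196 ^+ 2 <= 5 ^+ N.-1 * h ^+ 2.
Proof.
move=> k_gt0 N_ge tot_le h_ge; have kN : (k ^ 2 <= 36 * N ^ 3)%N.
  have := totient_cube k_gt0; have : (totient k ^ 3 <= (2 * N) ^ 3)%N by rewrite leq_exp2r.
  by rewrite expnMn; lia.
have {kN} : k%:R ^+ 2 <= 36 * N%:R ^+ 3 :> R by rewrite -!natrX -natrM ler_nat.
have /ltW := exp5_ge_sextic N_ge; have : 0 < N%:R :> R by rewrite ltr0n; lia.
have : 0 < k%:R :> R by rewrite ltr0n.
move: (5 ^+ N.-1) (k%:R) (N%:R) h_ge => Y x M h_ge x_gt0 M_gt0 YM xM.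
have h_ge' : 1 / (3 * M ^+ 3) <= h.
  apply: le_trans h_ge; rewrite ler_pdivlMr ?exprn_gt0 // mul1r ler_pdivrMl ?mulr_gt0 ?exprn_gt0 //.
  by rewrite (le_trans xM) //; lra.
have Y_gt0 : 0 < Y by apply: lt_le_trans YM; rewrite mulr_gt0 ?exprn_gt0 //; lra.
apply: (@le_trans _ _ (9 * (132 / 100 * 196 ^+ 2) * M ^+ 6 * (1 / (3 * M ^+ 3)) ^+ 2)).
  by have nz : M != 0 by [rewrite gt_eqF]; rewrite le_eqVlt; apply/orP; left; apply/eqP; field.
have M_ge0 := ltW M_gt0.
apply: ler_pM => //; first by rewrite mulr_ge0 ?exprn_ge0 //; lra.
  exact: sqr_ge0.
have : 0 <= 1 / (3 * M ^+ 3) by rewrite divr_ge0 ?mulr_ge0 ?exprn_ge0.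
by move=> inv_ge0; rewrite lerXn2r ?nnegrE // (le_trans inv_ge0).
Qed.

(** The exponent [r] enters through [(p^2 / 5^n)^r], so the least value [r0] and a lower bound [h0]
    of [h] are enough. *)
Lemma generic_inequality_from (p n r r0 : nat) (h0 h : R) :
  0 < h0 -> h0 <= h -> (1 / 5) ^+ n * p%:R ^+ 2 <= 1 :> R -> (0 < n * r0)%N -> (r0 <= r)%N ->
  132 / 100 * 196 ^+ 2 / h0 ^+ 2 * (1 / 5) ^+ (n * r0).-1 * (p%:R ^+ 2) ^+ r0 < 1 ->
  132 / 100 * 196 ^+ 2 * (p%:R ^+ r) ^+ 2 <= 5 ^+ (n * r).-1 * h ^+ 2.
Proof.
move=> h0_gt0 h0h Bp nr0 r0r num; have K_ge0 : 0 <= 132 / 100 * 196 ^+ 2 / h0 ^+ 2.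
  by rewrite divr_ge0 ?sqr_ge0 //; lra.
have := geometric_lt1 K_ge0 _ _ Bp nr0 r0r num; rewrite exprAC => /(_ _ _)/wrap[].
- by lra.
- exact: sqr_ge0.
rewrite expr_div_n expr1n mul1r mulrAC ltr_pdivrMr ?exprn_gt0 // mul1r => /ltW.
rewrite mulrAC ler_pdivrMr ?exprn_gt0 // => /le_trans; apply.
by rewrite ler_wpM2l ?exprn_ge0 // lerXn2r ?nnegrE ?(le_trans _ h0h) ?(ltW h0_gt0).
Qed.

Lemma sqr_le_exp5 (n : nat) : (4 <= n)%N -> (16 * n ^ 2 <= 5 ^ n)%N.
Proof.
elim: n => // n IHn; rewrite leq_eqVlt => /orP[/eqP<- //|n_ge].
by have := IHn n_ge; rewrite (expnS 5 n); move: (5 ^ n)%N => x; nia.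
Qed.

(** If [n >= 21], the check at [r = 1] succeeds for all [k] at once. If [n <= 20], finitely many [k]
    remain, each checked at the least [r] with [n r >= 21]. *)
Lemma generic_inequality_prime_power (p a n r : nat) (h : R) (k := (p ^ a.+1)%N) :
  prime p -> (2 < k)%N -> k \notin [:: 3; 4; 5; 7]%N -> totient k = (2 * n)%N -> (21 <= n * r)%N ->
  12 / k%:R ^+ 2 <= h -> (k = 11%N -> 1 / 5 <= h) ->
  132 / 100 * 196 ^+ 2 * (p%:R ^+ r) ^+ 2 <= 5 ^+ (n * r).-1 * h ^+ 2.
Proof.
move=> p_pr k_gt2 k_special; rewrite totient_pfactor //= => tot nr_ge h_ge h11.
have p_gt1 := prime_gt1 p_pr; have pa_gt0 : (0 < p ^ a)%N by rewrite expn_gt0 prime_gt0.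
have r_gt0 : (0 < r)%N by case: (r) nr_ge => //; rewrite muln0.
have [n_gt20|n_le20] := leqP 21 n.
  (* For prime powers the estimate of [k^2] gains a factor [p]. It gives [h >= p / (3 n^3)], whose
     square cancels the [p^2] in the inequality. *)
  have kp : (k ^ 2 * p <= 36 * n ^ 3)%N.
    suff : (2 * (k ^ 2 * p) <= 9 * (p.-1 * p ^ a) ^ 3)%N by rewrite tot expnMn; lia.
    rewrite /k (expnS p a) !expnMn.
    move: k_gt2 pa_gt0; rewrite /k (expnS p a); move: (p ^ a)%N => x.
    by case: (p) p_gt1 => [|[|[|q]]] //= _; nia.
  have n_gt0 : (0 < n)%N by apply: leq_trans n_gt20.
  (* From [p^3 <= k^2 p <= 36 n^3] follows [p <= 4 n]. *)
  have p2 : (p ^ 2 <= 5 ^ n)%N.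
    apply: leq_trans (sqr_le_exp5 (leq_trans _ n_gt20)) => //.
    have : (p ^ 3 <= (4 * n) ^ 3)%N.
      apply: (@leq_trans (k ^ 2 * p)); last by rewrite expnMn; lia.
      by rewrite expnSr leq_mul2r leq_exp2r // /k expnS leq_pmulr ?orbT.
    by rewrite leq_exp2r // => p_le; rewrite (@leq_trans ((4 * n) ^ 2)) ?leq_exp2r // expnMn.
  have n3 : 0 < 3 * n%:R ^+ 3 :> R by rewrite mulr_gt0 ?exprn_gt0 ?ltr0n.
  have p_gt0 : 0 < p%:R :> R by rewrite ltr0n prime_gt0.
  apply: (@generic_inequality_from p n r 1 (p%:R / (3 * n%:R ^+ 3))) => //; rewrite ?muln1 //.
  - exact: divr_gt0.
  - apply: le_trans h_ge; rewrite ler_pdivrMr // mulrAC ler_pdivlMr ?exprn_gt0 ?ltr0n //.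
        have : (k ^ 2 * p)%:R <= (36 * n ^ 3)%:R :> R by rewrite ler_nat.
      by rewrite !natrM !natrX; lra.
    by rewrite (leq_trans _ k_gt2).
  - by rewrite expr_div_n expr1n mulrAC mul1r ler_pdivrMr ?exprn_gt0 // mul1r -!natrX ler_nat.
  have := exp5_ge_sextic n_gt20; rewrite expr1 !expr_div_n expr1n.
  have Y_gt0 : 0 < 5 ^+ n.-1 :> R by rewrite exprn_gt0.
  move: (5 ^+ n.-1) Y_gt0 => Y Y_gt0 lt.
  rewrite (_ : _ * _ = 9 * (132 / 100 * 196 ^+ 2) * n%:R ^+ 6 / Y).
    by rewrite ltr_pdivrMr // mul1r.
  have nz_n : n%:R != 0 :> R by rewrite pnatr_eq0 -lt0n.
  by field; rewrite nz_n !gt_eqF.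
have {}tot_le : (p.-1 * p ^ a <= 40)%N by lia.
have [a0|a_gt0] := posnP a.
  have p_lt : (p < 42)%N by move: tot_le; rewrite a0 expn0; lia.
  have : p \in [seq q <- iota 0 42 | prime q] by rewrite mem_filter p_pr mem_iota.
  rewrite (_ : [seq q <- _ | _] = [:: 2; 3; 5; 7; 11; 13; 17; 19; 23; 29; 31; 37; 41]%N) //.
  rewrite !inE; move: k_special k_gt2 tot h_ge h11; rewrite /k a0 expn1 expn0 muln1.
  move=> k_special k_gt2 tot h_ge h11.
  do 12?[case/orP]; move/eqP => Dp; subst p => //=.
  - have Dn : n = 5%N by lia.
    subst n; apply: (@generic_inequality_from _ _ _ 5 (1 / 5)) => //;
      [lra | exact: h11 | lra | lia | lra].
  - have Dn : n = 6%N by lia.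
    subst n; apply: (@generic_inequality_from _ _ _ 4 (12 / 13 ^+ 2)) => //;
      [lra | lra | lia | lra].
  - have Dn : n = 8%N by lia.
    subst n; apply: (@generic_inequality_from _ _ _ 3 (12 / 17 ^+ 2)) => //;
      [lra | lra | lia | lra].
  - have Dn : n = 9%N by lia.
    subst n; apply: (@generic_inequality_from _ _ _ 3 (12 / 19 ^+ 2)) => //;
      [lra | lra | lia | lra].
  - have Dn : n = 11%N by lia.
    subst n; apply: (@generic_inequality_from _ _ _ 2 (12 / 23 ^+ 2)) => //;
      [lra | lra | lia | lra].
  - have Dn : n = 14%N by lia.
    subst n; apply: (@generic_inequality_from _ _ _ 2 (12 / 29 ^+ 2)) => //;
      [lra | lra | lia | lra].
  - have Dn : n = 15%N by lia.
    subst n; apply: (@generic_inequality_from _ _ _ 2 (12 / 31 ^+ 2)) => //;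
      [lra | lra | lia | lra].
  - have Dn : n = 18%N by lia.
    subst n; apply: (@generic_inequality_from _ _ _ 2 (12 / 37 ^+ 2)) => //;
      [lra | lra | lia | lra].
  - have Dn : n = 20%N by lia.
    subst n; apply: (@generic_inequality_from _ _ _ 2 (12 / 41 ^+ 2)) => //;
      [lra | lra | lia | lra].
have p_le : (p < 7)%N.
  have : (p <= p ^ a)%N by rewrite -{1}(expn1 p) leq_exp2l.
  by nia.
have : p \in [seq q <- iota 0 7 | prime q] by rewrite mem_filter p_pr mem_iota.
rewrite (_ : [seq q <- _ | _] = [:: 2; 3; 5]%N) //.
have a_lt : (a < 6)%N.
  rewrite -(ltn_exp2l _ _ (isT : 1 < 2)%N); apply: (@leq_ltn_trans 40) => //.
  apply: leq_trans tot_le; rewrite (@leq_trans (p ^ a)) ?leq_exp2r //.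
  by rewrite leq_pmull // -ltnS prednK // ltnW.
rewrite !inE => /or3P[] /eqP Dp; subst p; move: k_special k_gt2 tot h_ge h11 tot_le; rewrite /k;
  case: a a_gt0 a_lt {k pa_gt0} => [|[|[|[|[|[|a]]]]]] //= _ _ k_special k_gt2 tot h_ge h11 tot_le.
- have Dn : n = 2%N by lia.
  subst n; apply: (@generic_inequality_from _ _ _ 11 (12 / 8 ^+ 2)) => //; [lra | lra | lia | lra].
- have Dn : n = 4%N by lia.
  subst n; apply: (@generic_inequality_from _ _ _ 6 (12 / 16 ^+ 2)) => //; [lra | lra | lia | lra].
- have Dn : n = 8%N by lia.
  subst n; apply: (@generic_inequality_from _ _ _ 3 (12 / 32 ^+ 2)) => //; [lra | lra | lia | lra].
- have Dn : n = 16%N by lia.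
  subst n; apply: (@generic_inequality_from _ _ _ 2 (12 / 64 ^+ 2)) => //; [lra | lra | lia | lra].
- have Dn : n = 3%N by lia.
  subst n; apply: (@generic_inequality_from _ _ _ 7 (12 / 9 ^+ 2)) => //; [lra | lra | lia | lra].
- have Dn : n = 9%N by lia.
  subst n; apply: (@generic_inequality_from _ _ _ 3 (12 / 27 ^+ 2)) => //; [lra | lra | lia | lra].
- have Dn : n = 10%N by lia.
  subst n; apply: (@generic_inequality_from _ _ _ 3 (12 / 25 ^+ 2)) => //; [lra | lra | lia | lra].
Qed.

End GenericNumerics.

Lemma norm_pos_le (R : realDomainType) (x M : R) : 0 < x -> x <= M -> 0 < `|x| <= M.
Proof. by move=> x_gt0; rewrite gtr0_norm // x_gt0. Qed.

(** * Degree bounds from auxiliary functions *)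

Definition path_dim_bound (s k N : nat) : Prop :=
  [/\ (s = 3%N /\ k = 3%N -> N <= 25)%N, (s = 3%N /\ k = 7%N -> N <= 21)%N,
      (s = 7%N /\ k = 7%N -> N <= 21)%N &
      (~ (s = 3%N /\ k = 3%N) -> ~ (s = 3%N /\ k = 7%N) -> ~ (s = 7%N /\ k = 7%N) -> N <= 20)%N].

(* [S] is the field [K] and [O] its ring of integers; [rho0] is the inclusion, and [rho]
   lists each other real embedding [e] times, as do the automorphisms of a Galois
   closure of degree [e] over [K]. *)
Section AuxiliaryFunction.

Variables (R : realFieldType) (S : comNzRingType) (O : S -> Prop) (e m N : nat).
Variables (rho0 : {rmorphism S -> R}) (rho : 'I_m -> {rmorphism S -> R}).
Hypothesis e_gt0 : (0 < e)%N.
Hypothesis mE : m = (e * N.-1)%N.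
Hypothesis O1 : O 1.
Hypothesis OB : forall x y, O x -> O y -> O (x - y).
Hypothesis OM : forall x y, O x -> O y -> O (x * y).
Hypothesis norm_ge1 : forall x, O x -> x != 0 ->
  1 <= `|rho0 x| ^+ e * \prod_(i < m) `|rho i x|.

Lemma O0 : O 0. Proof. by rewrite -(subrr 1); apply: OB. Qed.
Lemma ON x : O x -> O (- x). Proof. by rewrite -sub0r; apply: OB O0. Qed.
Lemma OD x y : O x -> O y -> O (x + y).
Proof. by move=> Ox /ON; rewrite -{2}[y]opprK; apply: OB. Qed.
Lemma Onat n : O n%:R.
Proof. by elim: n => [|n IHn]; [apply: O0 | rewrite -natr1; apply: OD]. Qed.
Lemma OX x n : O x -> O (x ^+ n).
Proof. by move=> Ox; elim: n => [|n IHn]; [rewrite expr0 | rewrite exprS; apply: OM]. Qed.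

(** The conjugates are listed with multiplicity [e] and [m = e (N - 1)], so the norm inequality is
    the [e]-th power of the conclusion. [Cg] and [Ch] bound the norms of [G] and [H] with the factor
    at the identity removed. *)
Lemma auxiliary_bound (F G H : S) (C B Cg Ch : R) (a b : nat) :
  O F -> rho0 F != 0 -> `|rho0 F| <= C -> 0 <= B -> 0 <= Cg -> 0 <= Ch ->
  (forall i, 0 <= rho i G) -> (forall i, 0 <= rho i H) ->
  (forall i, `|rho i F| <= B * rho i G ^+ a * rho i H ^+ b) ->
  \prod_(i < m) rho i G <= Cg ^+ e -> \prod_(i < m) rho i H <= Ch ^+ e ->
  1 <= C * B ^+ N.-1 * Cg ^+ a * Ch ^+ b.
Proof.
move=> OF nzF FC B_ge0 Cg_ge0 Ch_ge0 G_ge0 H_ge0 FB GC HC.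
have nz : F != 0 by apply: contraNneq nzF => ->; rewrite rmorph0.
have C_ge0 := le_trans (normr_ge0 _) FC.
rewrite -(@expr_ge1 _ e) ?mulr_ge0 ?exprn_ge0 //.
apply: le_trans (norm_ge1 OF nz) _.
have Eprod : \prod_(i < m) (B * rho i G ^+ a * rho i H ^+ b)
    = (B ^+ N.-1) ^+ e * (\prod_(i < m) rho i G) ^+ a * (\prod_(i < m) rho i H) ^+ b.
  by rewrite !big_split /= !prodrXl prodr_const card_ord -exprM mulnC -mE.
rewrite -2!mulrA exprMn; apply: ler_pM; rewrite ?exprn_ge0 ?normr_ge0 //.
- by apply: prodr_ge0 => i _.
- by rewrite lerXn2r ?nnegrE ?normr_ge0.
apply: (@le_trans _ _ (\prod_(i < m) (B * rho i G ^+ a * rho i H ^+ b))).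
  by apply: ler_prod => i _; rewrite normr_ge0 FB.
have Gp : 0 <= \prod_(i < m) rho i G by apply: prodr_ge0.
have Hp : 0 <= \prod_(i < m) rho i H by apply: prodr_ge0.
rewrite Eprod mulrA !exprMn; apply: ler_pM; rewrite ?mulr_ge0 ?exprn_ge0 //.
  by rewrite ler_wpM2l ?exprn_ge0 // exprAC lerXn2r ?nnegrE ?exprn_ge0.
by rewrite exprAC lerXn2r ?nnegrE ?exprn_ge0.
Qed.

(** Here [F] is a weighted product of factors [A + c]. One bound on each factor at [rho0] provides
    both that [F] is nonzero and that it is at most [M^(sumn w)]. *)
Lemma auxiliary_bound_factors (A G H : S) (cs : seq S) (w : seq nat) (M B Cg Ch : R) (a b : nat) :
  O A -> (forall c, c \in cs -> O c) -> size cs = size w -> 1 <= M ->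
  (forall c, c \in cs -> 0 < `|rho0 A + rho0 c| <= M) -> 0 <= B -> 0 <= Cg -> 0 <= Ch ->
  (forall i, 0 <= rho i G) -> (forall i, 0 <= rho i H) ->
  (forall i, \prod_(p <- zip [seq rho i c | c <- cs] w) `|rho i A + p.1| ^+ p.2
     <= B * rho i G ^+ a * rho i H ^+ b) ->
  \prod_(i < m) rho i G <= Cg ^+ e -> \prod_(i < m) rho i H <= Ch ^+ e ->
  1 <= M ^+ sumn w * B ^+ N.-1 * Cg ^+ a * Ch ^+ b.
Proof.
move=> OA Ocs szw M_ge1 csM B_ge0 Cg_ge0 Ch_ge0 G_ge0 H_ge0 FB GC HC.
pose F := \prod_(p <- zip cs w) (A + p.1) ^+ p.2.
have rhoF (f : {rmorphism S -> R}) :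
    `|f F| = \prod_(p <- zip [seq f c | c <- cs] w) `|f A + p.1| ^+ p.2.
  rewrite rmorph_prod normr_prod /F; elim: cs w {szw Ocs csM FB F} => [|c cs IHcs] [|k w] //=.
  - by rewrite !big_nil.
  - by rewrite !big_nil.
  - by rewrite !big_nil.
  by rewrite !big_cons IHcs rmorphXn rmorphD normrX.
apply: (@auxiliary_bound F G H) => //; last by move=> i; rewrite rhoF.
- rewrite /F; elim: cs w {szw csM FB F rhoF} Ocs => [|c cs IHcs] [|k w] Ocs; rewrite ?big_nil //.
  rewrite big_cons; apply: OM; first by apply/OX/OD/Ocs/mem_head.
  by apply: IHcs => x x_cs; apply: Ocs; rewrite inE x_cs orbT.
- rewrite -normr_gt0 rhoF; elim: cs w {szw FB F rhoF Ocs} csM => [|c cs IHcs] [|k w] csM;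
    rewrite /= ?big_nil ?ltr01 //.
  rewrite big_cons mulr_gt0 //; first by rewrite exprn_gt0 //; have /andP[] := csM c (mem_head _ _).
  by apply: IHcs => x x_cs; apply: csM; rewrite inE x_cs orbT.
rewrite rhoF; elim: cs w szw {FB F rhoF Ocs} csM => [|c cs IHcs] [|k w] //= => [_ _|[szw] csM].
  by rewrite big_nil.
rewrite big_cons exprD ler_pM ?exprn_ge0 //.
- by apply: prodr_ge0 => p _; rewrite exprn_ge0.
- have /andP[_ cM] := csM c (mem_head _ _).
  by rewrite lerXn2r ?nnegrE // (le_trans ler01).
by apply: IHcs => // x x_cs; apply: csM; rewrite inE x_cs orbT.
Qed.

(** * Degree bounds for each kind of index pair *)

Variable A : S.
Hypothesis OA : O A.
Hypothesis A_gt4 : 4 < rho0 A.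
Hypothesis A_lt196 : rho0 A < 196.
Hypothesis A_conj_gt0 : forall i, 0 < rho i A.

Lemma prod_rho1 : \prod_(i < m) rho i 1 <= 1 ^+ e :> R.
Proof. by rewrite expr1n big1 // => i _; rewrite rmorph1. Qed.

(* [x (2 - x) (1 - x)^2 = v (1 - v)] with [v = x (2 - x)]. *)
Lemma degree_conj_lt2 : (forall i, rho i A < 2) -> (N < 17)%N.
Proof.
move=> A_lt2; rewrite ltnNge; apply/negP => N_ge.
suff : 1 <= 196 ^+ 4 * (1 / 4) ^+ N.-1 * 1 ^+ 0 * 1 ^+ 0 :> R.
  rewrite !expr0 !mulr1 leNgt => /negP; apply.
  apply: (@le_lt_trans _ _ (196 ^+ 4 * (1 / 4) ^+ 16)); last by lra.
  apply: ler_wpM2l; first by rewrite exprn_ge0.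
  by apply: ler_wiXn2l; [lra | lra | case: (N) N_ge].
apply: (@auxiliary_bound_factors A 1 1 [:: 0; - 2; - 1] [:: 1; 1; 2]%N 196) => //.
- by move=> c; rewrite !inE => /or3P[] /eqP->; [apply: O0 | apply/ON/Onat | apply/ON/O1].
- by lra.
- move=> c; rewrite !inE => /or3P[] /eqP->; rewrite ?rmorphN ?rmorph0 ?rmorph1 ?rmorph_nat.
  + by apply: norm_pos_le; move: A_gt4 A_lt196; lra.
  + by apply: norm_pos_le; move: A_gt4 A_lt196; lra.
  + by apply: norm_pos_le; move: A_gt4 A_lt196; lra.
- by lra.
- by move=> i; rewrite rmorph1.
- by move=> i; rewrite rmorph1.
- move=> i; rewrite /= !big_cons big_nil /= rmorph1 !expr1n !mulr1.
  rewrite !rmorphN rmorph0 rmorph1 rmorph_nat addr0 !expr1.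
  have x0 := A_conj_gt0 i; have x2 := A_lt2 i; move: (rho i A) x0 x2 => x x0 x2.
  rewrite gtr0_norm // ltr0_norm ?subr_lt0 // real_normK ?num_real //.
  by have := sqr_ge0 (x * (2 - x) - 1 / 2); lra.
- exact: prod_rho1.
- exact: prod_rho1.
Qed.

(** This serves [s = k = 3], where [g = h = 3] and [4 a < 9]. The auxiliary function is
    [a^3 (a - 1)^3 (a - 2)^4], whose zeros are the integers in the range. *)
Lemma degree_conj_lt9_4 : (forall i, rho i A < 9 / 4) -> (N < 26)%N.
Proof.
move=> A_lt; rewrite ltnNge; apply/negP => N_ge.
suff : 1 <= 196 ^+ 10 * (11 / 100) ^+ N.-1 * 1 ^+ 0 * 1 ^+ 0 :> R.
  rewrite !expr0 !mulr1 leNgt => /negP; apply.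
  apply: (@le_lt_trans _ _ (196 ^+ 10 * (11 / 100) ^+ 25)); last by lra.
  apply: ler_wpM2l; first by rewrite exprn_ge0.
  by apply: ler_wiXn2l; [lra | lra | case: (N) N_ge].
apply: (@auxiliary_bound_factors A 1 1 [:: 0; - 1; - 2] [:: 3; 3; 4]%N 196) => //.
- by move=> c; rewrite !inE => /or3P[] /eqP->; [apply: O0 | apply/ON/O1 | apply/ON/Onat].
- by lra.
- move: A_gt4 A_lt196 => a4 a196 c; rewrite !inE => /or3P[] /eqP->;
    rewrite ?rmorphN ?rmorph0 ?rmorph1 ?rmorph_nat; apply: norm_pos_le; lra.
- by lra.
- by move=> i; rewrite rmorph1.
- by move=> i; rewrite rmorph1.
- move=> i; rewrite rmorph1 !expr0 !mulr1 /= !rmorphN rmorph0 rmorph1 rmorph_nat.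
  have x0 := A_conj_gt0 i; have x2 := A_lt i; move: (rho i A) x0 x2 => x x0 x2.
  apply: le_trans ((@grid_prod_le R 4 99 225 10707 35
      [:: (SgnNat false 0, SgnNat false 0, 3%N);
       (SgnNat true 10000, SgnNat true 10000, 3%N);
       (SgnNat true 20000, SgnNat true 20000, 4%N)])
      [:: 0; - 1; - 2] x _ _ _ _) _.
  + by vm_compute.
  + by cbv [factors_within R_of_signed map fst snd]; repeat split; lra.
  + exact: ltW.
  + by lra.
  + by cbn [sumn map snd foldr]; lra.
- exact: prod_rho1.
- exact: prod_rho1.
Qed.

(** [H] generates a quadratic field, in which its norm is 5; hence [N = 2 r] and the norm [5^r].
    With [rho0 H] replaced by a lower bound of the smaller root, what grows with [r] is a power of
    [(3 / 100)^2 * 5^3 < 1], so [r = 11] decides. The other pairs from 5 and 7 follow this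
    scheme. *)
Lemma degree_3_5 (H : S) (r : nat) :
  O H -> H ^+ 2 - 5 * H + 5 = 0 -> 0 < rho0 H < 4 -> (forall i, 0 < rho i H < 4) ->
  (forall i, 4 * rho i A < 3 * rho i H) -> N = (2 * r)%N ->
  \prod_(i < m) rho i H <= (5 ^+ r / rho0 H) ^+ e -> (r < 11)%N.
Proof.
move=> OH Hp h04 H04 AH NE prodH; rewrite ltnNge; apply/negP => r_ge.
have rootH (f : {rmorphism S -> R}) : f H ^+ 2 - 5 * f H + 5 = 0.
  by have := congr1 f Hp; rewrite !(rmorph_nat, rmorph0, rmorphXn, rmorphM, rmorphN, rmorphD).
have h_ge : 138 / 100 <= rho0 H by case: (root5_cases (rootH rho0)) => /andP[]; lra.
suff : 1 <= 197 ^+ 3 * (3 / 100) ^+ N.-1 * 1 ^+ 0 * (5 ^+ r / (138 / 100)) ^+ 3 :> R.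
  rewrite expr0 mulr1 leNgt NE => /negP; apply.
  rewrite (_ : _ * _ = 197 ^+ 3 / (138 / 100) ^+ 3 * (3 / 100) ^+ (2 * r).-1 * (5 ^+ 3) ^+ r).
    by apply: (geometric_lt1 _ _ _ _ _ r_ge) => //; lra.
  by rewrite (exprAC _ 3 r); move: (_ ^+ (2 * r).-1) (5 ^+ r) => X Y; lra.
apply: (@auxiliary_bound_factors A 1 H [:: 0; - 1; 1 - H] [:: 1; 1; 1]%N 197) => //.
- move=> c; rewrite !inE => /or3P[] /eqP->; [exact: O0 | exact/ON/O1 | exact: OB].
- by lra.
(* From [4 < a < 196] and [0 < h < 4], the number [a + 1 - h] lies strictly between 0 and 197. *)
- move: A_gt4 A_lt196 h04 => a4 a196 /andP[h4 h4']; have hq := sqr_ge0 (rho0 H - 2).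
  have hq' : 0 < rho0 H * (4 - rho0 H) by apply: mulr_gt0; rewrite ?subr_gt0.
  move=> c; rewrite !inE => /or3P[] /eqP->;
    rewrite ?(rmorph_nat, rmorph0, rmorph1, rmorphXn, rmorphM, rmorphN, rmorphD);
    apply: norm_pos_le; lra.
- by lra.
- by apply: divr_ge0; [apply: exprn_ge0 | lra].
- by move=> i; rewrite rmorph1.
- by move=> i; case/andP: (H04 i) => /ltW.
- move=> i; rewrite expr0 mulr1 /=.
  rewrite !(rmorph_nat, rmorph0, rmorph1, rmorphXn, rmorphM, rmorphN, rmorphD).
  exact: factors_le_3_5.
- exact: prod_rho1.
- apply: le_trans prodH _; have h_gt0 : 0 < rho0 H by case/andP: h04.
  rewrite lerXn2r ?nnegrE ?divr_ge0 ?exprn_ge0 ?(ltW h_gt0) //; try lra.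
  by apply: ler_wpM2l; rewrite ?exprn_ge0 // lef_pV2 ?posrE //; lra.
Qed.

Lemma degree_5_5 (H : S) (r : nat) :
  O H -> H ^+ 2 - 5 * H + 5 = 0 -> 0 < rho0 H < 4 -> (forall i, 0 < rho i H < 4) ->
  (forall i, 4 * rho i A < rho i H * rho i H) -> N = (2 * r)%N ->
  \prod_(i < m) rho i H <= (5 ^+ r / rho0 H) ^+ e -> (r < 11)%N.
Proof.
move=> OH Hp h04 H04 AH NE prodH; rewrite ltnNge; apply/negP => r_ge.
have rootH (f : {rmorphism S -> R}) : f H ^+ 2 - 5 * f H + 5 = 0.
  by have := congr1 f Hp; rewrite !(rmorph_nat, rmorph0, rmorphXn, rmorphM, rmorphN, rmorphD).
have h_ge : 138 / 100 <= rho0 H by case: (root5_cases (rootH rho0)) => /andP[]; lra.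
suff : 1 <= 197 ^+ 2 * (3 / 200) ^+ N.-1 * 1 ^+ 0 * (5 ^+ r / (138 / 100)) ^+ 4 :> R.
  rewrite expr0 mulr1 leNgt NE => /negP; apply.
  rewrite (_ : _ * _ = 197 ^+ 2 / (138 / 100) ^+ 4 * (3 / 200) ^+ (2 * r).-1 * (5 ^+ 4) ^+ r).
    by apply: (geometric_lt1 _ _ _ _ _ r_ge) => //; lra.
  by rewrite (exprAC _ 4 r); move: (_ ^+ (2 * r).-1) (5 ^+ r) => X Y; lra.
apply: (@auxiliary_bound_factors A 1 H [:: 0; 1 - H] [:: 1; 1]%N 197) => //.
- move=> c; rewrite !inE => /orP[] /eqP->; [exact: O0 | exact: OB].
- by lra.
- move: A_gt4 A_lt196 h04 => a4 a196 /andP[h4 h4']; have hq := sqr_ge0 (rho0 H - 2).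
  have hq' : 0 < rho0 H * (4 - rho0 H) by apply: mulr_gt0; rewrite ?subr_gt0.
  move=> c; rewrite !inE => /orP[] /eqP->;
    rewrite ?(rmorph_nat, rmorph0, rmorph1, rmorphXn, rmorphM, rmorphN, rmorphD);
    apply: norm_pos_le; lra.
- by lra.
- by apply: divr_ge0; [apply: exprn_ge0 | lra].
- by move=> i; rewrite rmorph1.
- by move=> i; case/andP: (H04 i) => /ltW.
- move=> i; rewrite expr0 mulr1 /=.
  rewrite !(rmorph_nat, rmorph0, rmorph1, rmorphXn, rmorphM, rmorphN, rmorphD).
  exact: factors_le_5_5.
- exact: prod_rho1.
- apply: le_trans prodH _; have h_gt0 : 0 < rho0 H by case/andP: h04.
  rewrite lerXn2r ?nnegrE ?divr_ge0 ?exprn_ge0 ?(ltW h_gt0) //; try lra.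
  by apply: ler_wpM2l; rewrite ?exprn_ge0 // lef_pV2 ?posrE //; lra.
Qed.

Lemma degree_3_7 (H : S) (r : nat) :
  O H -> H ^+ 3 - 7 * H ^+ 2 + 14 * H - 7 = 0 -> 0 < rho0 H < 4 -> (forall i, 0 < rho i H < 4) ->
  (forall i, 4 * rho i A < 3 * rho i H) -> N = (3 * r)%N ->
  \prod_(i < m) rho i H <= (7 ^+ r / rho0 H) ^+ e -> (r < 8)%N.
Proof.
move=> OH Hp h04 H04 AH NE prodH; rewrite ltnNge; apply/negP => r_ge.
have rootH (f : {rmorphism S -> R}) : f H ^+ 3 - 7 * f H ^+ 2 + 14 * f H - 7 = 0.
  by have := congr1 f Hp; rewrite !(rmorph_nat, rmorph0, rmorphXn, rmorphM, rmorphN, rmorphD).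
have h_ge : 3 / 4 <= rho0 H by case: (root7_cases h04 (rootH rho0)) => /andP[]; lra.
suff : 1 <= 197 ^+ 11 * (1 / 400) ^+ N.-1 * 1 ^+ 0 * (7 ^+ r / (3 / 4)) ^+ 5 :> R.
  rewrite expr0 mulr1 leNgt NE => /negP; apply.
  rewrite (_ : _ * _ = 197 ^+ 11 / (3 / 4) ^+ 5 * (1 / 400) ^+ (3 * r).-1 * (7 ^+ 5) ^+ r).
    by apply: (geometric_lt1 _ _ _ _ _ r_ge) => //; lra.
  by rewrite (exprAC _ 5 r); move: (_ ^+ (3 * r).-1) (7 ^+ r) => X Y; lra.
apply: (@auxiliary_bound_factors A 1 H [:: 0; - 1; 1 - H; - 3 + 4 * H - H ^+ 2]
  [:: 2; 4; 4; 1]%N 197) => //.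
- move=> c; rewrite !inE => /or4P[] /eqP->; [exact: O0 | exact/ON/O1 | exact: OB |].
  by apply/OB/OX => //; apply: OD; [apply/ON/Onat | apply/OM => //; apply: Onat].
- by lra.
(* [- 3 + 4 h - h^2 = 1 - (h - 2)^2] is above -3 and at most 1, so the last factor also stays
   between 0 and 197. *)
- move: A_gt4 A_lt196 h04 => a4 a196 /andP[h4 h4']; have hq := sqr_ge0 (rho0 H - 2).
  have hq' : 0 < rho0 H * (4 - rho0 H) by apply: mulr_gt0; rewrite ?subr_gt0.
  move=> c; rewrite !inE => /or4P[] /eqP->;
    rewrite ?(rmorph_nat, rmorph0, rmorph1, rmorphXn, rmorphM, rmorphN, rmorphD);
    apply: norm_pos_le; lra.
- by lra.
- by apply: divr_ge0; [apply: exprn_ge0 | lra].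
- by move=> i; rewrite rmorph1.
- by move=> i; case/andP: (H04 i) => /ltW.
- move=> i; rewrite expr0 mulr1 /=.
  rewrite !(rmorph_nat, rmorph0, rmorph1, rmorphXn, rmorphM, rmorphN, rmorphD).
  exact: factors_le_3_7.
- exact: prod_rho1.
- apply: le_trans prodH _; have h_gt0 : 0 < rho0 H by case/andP: h04.
  rewrite lerXn2r ?nnegrE ?divr_ge0 ?exprn_ge0 ?(ltW h_gt0) //; try lra.
  by apply: ler_wpM2l; rewrite ?exprn_ge0 // lef_pV2 ?posrE //; lra.
Qed.

Lemma degree_7_7 (H : S) (r : nat) :
  O H -> H ^+ 3 - 7 * H ^+ 2 + 14 * H - 7 = 0 -> 0 < rho0 H < 4 -> (forall i, 0 < rho i H < 4) ->
  (forall i, 4 * rho i A < rho i H * rho i H) -> N = (3 * r)%N ->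
  \prod_(i < m) rho i H <= (7 ^+ r / rho0 H) ^+ e -> (r < 8)%N.
Proof.
move=> OH Hp h04 H04 AH NE prodH; rewrite ltnNge; apply/negP => r_ge.
have rootH (f : {rmorphism S -> R}) : f H ^+ 3 - 7 * f H ^+ 2 + 14 * f H - 7 = 0.
  by have := congr1 f Hp; rewrite !(rmorph_nat, rmorph0, rmorphXn, rmorphM, rmorphN, rmorphD).
have h_ge : 3 / 4 <= rho0 H by case: (root7_cases h04 (rootH rho0)) => /andP[]; lra.
suff : 1 <= 197 ^+ 5 * (1 / 100) ^+ N.-1 * 1 ^+ 0 * (7 ^+ r / (3 / 4)) ^+ 5 :> R.
  rewrite expr0 mulr1 leNgt NE => /negP; apply.
  rewrite (_ : _ * _ = 197 ^+ 5 / (3 / 4) ^+ 5 * (1 / 100) ^+ (3 * r).-1 * (7 ^+ 5) ^+ r).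
    by apply: (geometric_lt1 _ _ _ _ _ r_ge) => //; lra.
  by rewrite (exprAC _ 5 r); move: (_ ^+ (3 * r).-1) (7 ^+ r) => X Y; lra.
apply: (@auxiliary_bound_factors A 1 H [:: 0; 1 - H] [:: 2; 3]%N 197) => //.
- move=> c; rewrite !inE => /orP[] /eqP->; [exact: O0 | exact: OB].
- by lra.
- move: A_gt4 A_lt196 h04 => a4 a196 /andP[h4 h4']; have hq := sqr_ge0 (rho0 H - 2).
  have hq' : 0 < rho0 H * (4 - rho0 H) by apply: mulr_gt0; rewrite ?subr_gt0.
  move=> c; rewrite !inE => /orP[] /eqP->;
    rewrite ?(rmorph_nat, rmorph0, rmorph1, rmorphXn, rmorphM, rmorphN, rmorphD);
    apply: norm_pos_le; lra.
- by lra.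
- by apply: divr_ge0; [apply: exprn_ge0 | lra].
- by move=> i; rewrite rmorph1.
- by move=> i; case/andP: (H04 i) => /ltW.
- move=> i; rewrite expr0 mulr1 /=.
  rewrite !(rmorph_nat, rmorph0, rmorph1, rmorphXn, rmorphM, rmorphN, rmorphD).
  exact: factors_le_7_7.
- exact: prod_rho1.
- apply: le_trans prodH _; have h_gt0 : 0 < rho0 H by case/andP: h04.
  rewrite lerXn2r ?nnegrE ?divr_ge0 ?exprn_ge0 ?(ltW h_gt0) //; try lra.
  by apply: ler_wpM2l; rewrite ?exprn_ge0 // lef_pV2 ?posrE //; lra.
Qed.

Lemma degree_5_7 (G H : S) (r : nat) :
  O G -> O H -> G ^+ 2 - 5 * G + 5 = 0 -> H ^+ 3 - 7 * H ^+ 2 + 14 * H - 7 = 0 ->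
  0 < rho0 G < 4 -> (forall i, 0 < rho i G < 4) ->
  0 < rho0 H < 4 -> (forall i, 0 < rho i H < 4) ->
  (forall i, 4 * rho i A < rho i G * rho i H) -> N = (6 * r)%N ->
  \prod_(i < m) rho i G <= (5 ^+ (3 * r) / rho0 G) ^+ e ->
  \prod_(i < m) rho i H <= (7 ^+ (2 * r) / rho0 H) ^+ e -> (r < 4)%N.
Proof.
move=> OG OH Gp Hp g04 G04 h04 H04 AGH NE prodG prodH; rewrite ltnNge; apply/negP => r_ge.
have rootG (f : {rmorphism S -> R}) : f G ^+ 2 - 5 * f G + 5 = 0.
  by have := congr1 f Gp; rewrite !(rmorph_nat, rmorph0, rmorphXn, rmorphM, rmorphN, rmorphD).
have rootH (f : {rmorphism S -> R}) : f H ^+ 3 - 7 * f H ^+ 2 + 14 * f H - 7 = 0.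
  by have := congr1 f Hp; rewrite !(rmorph_nat, rmorph0, rmorphXn, rmorphM, rmorphN, rmorphD).
have g_ge : 138 / 100 <= rho0 G by case: (root5_cases (rootG rho0)) => /andP[]; lra.
have h_ge : 3 / 4 <= rho0 H by case: (root7_cases h04 (rootH rho0)) => /andP[]; lra.
suff : 1 <= 197 ^+ 14 * (11 / 10 ^+ 9) ^+ N.-1 * (5 ^+ (3 * r) / (138 / 100)) ^+ 14
    * (7 ^+ (2 * r) / (3 / 4)) ^+ 5 :> R.
  rewrite leNgt NE => /negP; apply.
  rewrite (_ : _ * _ = 197 ^+ 14 / (138 / 100) ^+ 14 / (3 / 4) ^+ 5
      * (11 / 10 ^+ 9) ^+ (6 * r).-1 * (5 ^+ 42 * 7 ^+ 10) ^+ r).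
    by apply: (geometric_lt1 _ _ _ _ _ r_ge) => //; lra.
  rewrite (exprMn r) (exprAC _ 42 r) (exprAC _ 10 r) !(mulnC _ r) !exprM.
  by move: (_ ^+ (r * 6).-1) (5 ^+ r) (7 ^+ r) => X Y Z; lra.
apply: (@auxiliary_bound_factors A G H [:: 0; - 1; 1 - G; 3 - 5 * H + H ^+ 2]
  [:: 2; 4; 6; 2]%N 197) => //.
- move=> c; rewrite !inE => /or4P[] /eqP->; [exact: O0 | exact/ON/O1 | exact: OB |].
  by apply: OD; [apply: OB; [apply: Onat | apply/OM => //; apply: Onat] | apply: OX].
- by lra.
- have g4 : rho0 G <= 4 by case/andP: g04 => _ /ltW.
  (* [3 - 5 h + h^2 = (h - 5 / 2)^2 - 13 / 4], so the last factor exceeds [4 - 13 / 4]; its upper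
     bound uses [h >= 3 / 4]. *)
  move: A_gt4 A_lt196 h04 => a4 a196 /andP[h4 h4']; have hq := sqr_ge0 (rho0 H - 5 / 2).
  have hq' : 0 <= (rho0 H - 3 / 4) * (4 - rho0 H) by apply: mulr_ge0; rewrite subr_ge0 // ltW.
  move=> c; rewrite !inE => /or4P[] /eqP->;
    rewrite ?(rmorph_nat, rmorph0, rmorph1, rmorphXn, rmorphM, rmorphN, rmorphD);
    apply: norm_pos_le; lra.
- by lra.
- by apply: divr_ge0; [apply: exprn_ge0 | lra].
- by apply: divr_ge0; [apply: exprn_ge0 | lra].
- by move=> i; case/andP: (G04 i) => /ltW.
- by move=> i; case/andP: (H04 i) => /ltW.
- move=> i; rewrite /=.
  rewrite !(rmorph_nat, rmorph0, rmorph1, rmorphXn, rmorphM, rmorphN, rmorphD).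
  by apply: factors_le_5_7.
- apply: le_trans prodG _; have g_gt0 : 0 < rho0 G by case/andP: g04.
  rewrite lerXn2r ?nnegrE ?divr_ge0 ?exprn_ge0 ?(ltW g_gt0) //; try lra.
  by apply: ler_wpM2l; rewrite ?exprn_ge0 // lef_pV2 ?posrE //; lra.
- apply: le_trans prodH _; have h_gt0 : 0 < rho0 H by case/andP: h04.
  rewrite lerXn2r ?nnegrE ?divr_ge0 ?exprn_ge0 ?(ltW h_gt0) //; try lra.
  by apply: ler_wpM2l; rewrite ?exprn_ge0 // lef_pV2 ?posrE //; lra.
Qed.

(** At the identity [|F| <= (196 * 196)^4 * 392^2 = 4 * 196^10]. The last numerical hypothesis is a
    fifth root of what is needed, and [132 / 100] is there because its fifth power exceeds 4. *)
Lemma degree_generic (H : S) (p r : nat) :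
  O H -> 0 < rho0 H < 4 -> (forall i, 0 < rho i H) -> (forall i, rho i A < rho i H) ->
  \prod_(i < m) rho i H <= (p%:R ^+ r / rho0 H) ^+ e ->
  (0 < p)%N -> 132 / 100 * 196 ^+ 2 * (p%:R ^+ r) ^+ 2 <= 5 ^+ N.-1 * rho0 H ^+ 2 -> False.
Proof.
move=> OH /andP[h_gt0 h_lt4] H_gt0 AH prodH p_gt0 num.
have X_gt0 : 0 < p%:R ^+ r / rho0 H by rewrite divr_gt0 ?exprn_gt0 ?ltr0n.
suff : 1 <= (4 * 196 ^+ 10) * (1 / 5 ^+ 5) ^+ N.-1 * 1 ^+ 0 * (p%:R ^+ r / rho0 H) ^+ 10 :> R.
  have {}num : 132 / 100 * 196 ^+ 2 * (p%:R ^+ r / rho0 H) ^+ 2 <= 5 ^+ N.-1.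
    by rewrite expr_div_n mulrA ler_pdivrMr // exprn_gt0.
  move: (p%:R ^+ r / _) X_gt0 num => X X_gt0 num.
  rewrite expr0 mulr1 expr_div_n expr1n (exprAC _ 5); move: (5 ^+ N.-1) num => Y num.
  have K_gt0 : 0 < 132 / 100 * 196 ^+ 2 :> R by lra.
  have Y_gt0 : 0 < Y by apply: lt_le_trans num; rewrite mulr_gt0 ?exprn_gt0.
  rewrite leNgt => /negP; apply.
  rewrite mulrAC mul1r ltr_pdivrMr ?exprn_gt0 // mul1r.
  apply: (@lt_le_trans _ _ ((132 / 100 * 196 ^+ 2 * X ^+ 2) ^+ 5)).
    rewrite exprMn -exprM ltr_pM2r ?exprn_gt0 //; lra.
  rewrite lerXn2r ?nnegrE ?(ltW Y_gt0) //.
  by rewrite mulr_ge0 ?(ltW K_gt0) // sqr_ge0.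
pose F := (A * (H - A)) ^+ 4 * (H - 2 * A) ^+ 2.
have rhoF (f : {rmorphism S -> R}) :
    f F = (f A * (f H - f A)) ^+ 4 * (f H - 2 * f A) ^+ 2.
  by rewrite /F !(rmorph_nat, rmorphXn, rmorphM, rmorphN, rmorphD).
move: A_gt4 A_lt196 => a4 a196.
apply: (@auxiliary_bound F 1 H) => //.
-
  by apply: OM; apply: OX; [apply: OM => //; apply: OB | apply: OB => //; apply: OM => //; apply: Onat].
- rewrite rhoF mulf_neq0 // expf_neq0 // ?mulf_neq0 //; try (apply/eqP; lra).
- rewrite rhoF normrM !normrX normrM.
  rewrite (_ : 4 * 196 ^+ 10 = (196 * 196) ^+ 4 * (392) ^+ 2); last by lra.
  apply: ler_pM; rewrite ?exprn_ge0 // ?mulr_ge0 //; apply: lerXn2r; rewrite ?nnegrE ?mulr_ge0 ?ler0n //.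
    by apply: ler_pM; rewrite ?normr_ge0 // ler_norml; apply/andP; split; lra.
  by rewrite ler_norml; apply/andP; split; lra.
- by apply: divr_ge0; rewrite ?exprn_ge0 ?ler0n.
- exact: ltW.
- by move=> i; rewrite rmorph1.
- by move=> i; apply: ltW.
- by move=> i; rewrite rhoF rmorph1 expr0 mulr1; apply: generic_factor_le.
- exact: prod_rho1.
Qed.

(* [H] stands for [4 - (2 cos (pi / k)) ^ 2]. *)
Record gamma_index (k : nat) (H : S) : Prop := GammaIndex {
  gi_int : O H;
  gi_bounds0 : 0 < rho0 H < 4;
  gi_bounds : forall i, 0 < rho i H < 4;
  gi_ge : 12 / k%:R ^+ 2 <= rho0 H;
  gi_totient : (totient k %| 2 * N)%N;
  gi_3 : k = 3%N -> H = 3;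
  gi_4 : k = 4%N -> H = 2;
  gi_5 : k = 5%N -> H ^+ 2 - 5 * H + 5 = 0;
  gi_7 : k = 7%N -> H ^+ 3 - 7 * H ^+ 2 + 14 * H - 7 = 0;
  gi_11 : k = 11%N -> H ^+ 5 - 11 * H ^+ 4 + 44 * H ^+ 3 - 77 * H ^+ 2 + 55 * H - 11 = 0;
  gi_unit : forall p q, prime p -> prime q -> p != q -> (p %| k)%N -> (q %| k)%N ->
    exists2 x, O x & x * H = 1;
  gi_prime_power : forall p a n, prime p -> k = (p ^ a.+1)%N -> totient k = (2 * n)%N ->
    exists2 x, O x & x * H ^+ n = p%:R }.

(** The norm of [x] is at least 1 in absolute value, so the norm of [H^n] is at most
    [p^N = p^(n r)], and the [n]-th root can be taken. *)
Lemma prod_le_of_divides (H x : S) (p n r : nat) :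
  O x -> x * H ^+ n = p%:R -> (0 < p)%N -> (0 < n)%N -> (0 < N)%N -> N = (n * r)%N ->
  0 < rho0 H -> (forall i, 0 < rho i H) ->
  \prod_(i < m) rho i H <= (p%:R ^+ r / rho0 H) ^+ e.
Proof.
move=> Ox xH p_gt0 n_gt0 N_gt0 NE h_gt0 H_gt0; have p_pos : 0 < p%:R :> R by rewrite ltr0n.
have val (f : {rmorphism S -> R}) : 0 < f H -> `|f x| = p%:R / f H ^+ n.
  move=> fH; have := congr1 f xH; rewrite rmorphM rmorphXn rmorph_nat => /(canRL (mulfK _))->.
    by rewrite gtr0_norm // divr_gt0 ?exprn_gt0.
  by rewrite gt_eqF ?exprn_gt0.
have nz : x != 0.
  apply/eqP => x0; have := congr1 rho0 xH; rewrite x0 mul0r rmorph0 rmorph_nat.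
  by move/eqP; rewrite eq_sym pnatr_eq0 -leqn0 leqNgt p_gt0.
have := norm_ge1 Ox nz; rewrite val //.
under eq_bigr => i _ do rewrite val // -exprVn.
rewrite big_split /= prodr_const card_ord prodrXl prodfV -exprVn.
set Q := \prod_(i < m) _; have Q_gt0 : 0 < Q by apply: prodr_gt0.
rewrite exprMn exprAC mulrACA -exprD -exprMn exprVn -invfM exprVn.
(* The identity contributes [e] and the other conjugates [e (N - 1)], in all [e N]. *)
have -> : (e + m = e * r * n)%N by rewrite mE -mulnS prednK // NE; lia.
rewrite ler_pdivlMr ?mul1r ?exprn_gt0 ?mulr_gt0 ?exprn_gt0 // exprM.
have hQ_ge0 : 0 <= rho0 H ^+ e * Q by apply: mulr_ge0; [apply/exprn_ge0/ltW | apply: ltW].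
rewrite ler_pXn2r ?nnegrE ?exprn_ge0 ?ler0n // => le.
by rewrite expr_div_n -exprM mulnC ler_pdivlMr ?exprn_gt0 // mulrC.
Qed.

Lemma even_totient_prime_power (p a : nat) :
  prime p -> (2 < p ^ a.+1)%N -> exists2 n, totient (p ^ a.+1) = (2 * n)%N & (0 < n)%N.
Proof.
move=> p_pr k_gt2; have : (0 < totient (p ^ a.+1))%N by rewrite totient_gt0 ltnW // ltnW.
have : ~~ odd (totient (p ^ a.+1)).
  rewrite totient_pfactor //=; have [p2|odd_p] := even_prime p_pr.
    by case: a k_gt2 => [|a]; rewrite p2 //= mul1n oddX.
  by case: (p) odd_p => //= q; rewrite oddM => /negbTE->.
move/even_halfK <-; rewrite -muln2 mulnC muln_gt0 => n_gt0.
by exists (totient (p ^ a.+1))./2.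
Qed.

Lemma prime_power_or_two_primes (k : nat) : (1 < k)%N ->
  (exists p a, prime p /\ k = (p ^ a.+1)%N) \/
  (exists p q, [/\ prime p, prime q, p != q, p %| k & q %| k]%N).
Proof.
move=> k_gt1; have k_gt0 := ltnW k_gt1; have p_pr := pdiv_prime k_gt1.
have [/p_natP|] := boolP ((pdiv k).-nat k).
  case=> -[|a] Dk; last by left; exists (pdiv k), a.
  by move: k_gt1; rewrite [k in (_ < k)%N]Dk expn0.
rewrite /pnat k_gt0 /= => /allPn[q]; rewrite mem_primes => /and3P[q_pr _ q_k] npq.
right; exists (pdiv k), q; split; rewrite ?pdiv_dvd //.
by rewrite eq_sym; move: npq; rewrite !inE.
Qed.

Lemma prod_le_prime_power (k p a n : nat) (H : S) :
  gamma_index k H -> (2 < k)%N -> prime p -> k = (p ^ a.+1)%N -> totient k = (2 * n)%N ->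
  (0 < N)%N -> exists2 r, N = (n * r)%N & \prod_(i < m) rho i H <= (p%:R ^+ r / rho0 H) ^+ e.
Proof.
move=> gH k_gt2 p_pr Dk tot N_gt0; have n_gt0 : (0 < n)%N.
  by have := totient_gt0 k; rewrite tot (ltn_trans _ k_gt2) // muln_gt0.
have /dvdnP[r NE] : (n %| N)%N by have := gi_totient gH; rewrite tot dvdn_pmul2l.
rewrite mulnC in NE; have [x Ox xH] := gi_prime_power gH p_pr Dk tot.
exists r => //; apply: prod_le_of_divides Ox xH _ _ _ NE _ _; rewrite ?(prime_gt0 p_pr) //.
  by case/andP: (gi_bounds0 gH).
by move=> i; case/andP: (gi_bounds gH i).
Qed.

(** When two primes divide [k], [H] is a unit, and the prime power argument is used with [p = 1] and
    [n = 1]. *)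
Lemma degree_generic_index (k : nat) (H : S) :
  gamma_index k H -> (2 < k)%N -> k \notin [:: 3; 4; 5; 7]%N ->
  (forall i, rho i A < rho i H) -> (N < 21)%N.
Proof.
move=> gH k_gt2 k_special AH; rewrite ltnNge; apply/negP => N_ge.
have N_gt0 : (0 < N)%N by apply: leq_trans N_ge.
have k_gt0 : (0 < k)%N by apply: leq_trans k_gt2.
have [h_gt0 h_lt4] := andP (gi_bounds0 gH).
have H_gt0 i : 0 < rho i H by case/andP: (gi_bounds gH i).
have tot_le : (totient k <= 2 * N)%N by rewrite dvdn_leq ?muln_gt0 ?(gi_totient gH).
case: (prime_power_or_two_primes (ltnW k_gt2)) => [[p [a [p_pr Dk]]] | [p [q [p_pr q_pr npq p_k q_k]]]].
  have k_gt2' := k_gt2; rewrite Dk in k_gt2'.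
  have [n tot n_gt0] := even_totient_prime_power p_pr k_gt2'.
  rewrite -Dk in tot; have [r NE prodH] := prod_le_prime_power gH k_gt2 p_pr Dk tot N_gt0.
  apply: (degree_generic (gi_int gH) (gi_bounds0 gH) H_gt0 AH prodH (prime_gt0 p_pr)).
  rewrite NE; rewrite NE in N_ge; apply: (@generic_inequality_prime_power R p a) => //.
  - by rewrite -Dk.
  - by rewrite -Dk.
  - by rewrite -Dk (gi_ge gH).
  (* For 11 the bound [12 / k^2] is too weak. The quintic is negative on [(0, 1/5)], so its root is
     at least [1/5]. *)
  rewrite -Dk => k11; have := congr1 rho0 (gi_11 gH k11).
  rewrite !(rmorph_nat, rmorph0, rmorphXn, rmorphM, rmorphN, rmorphD) leNgt => root.
  apply/negP => h_lt; have h2 : 0 < rho0 H ^+ 2 * (77 - 44 * rho0 H).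
    by rewrite mulr_gt0 ?exprn_gt0 // subr_gt0; lra.
  have h4 : 0 < rho0 H ^+ 4 * (11 - rho0 H) by rewrite mulr_gt0 ?exprn_gt0 // subr_gt0; lra.
  by lra.
have [x Ox xH] := gi_unit gH p_pr q_pr npq p_k q_k.
have prodH := prod_le_of_divides (n := 1) Ox (xH : x * H ^+ 1 = 1%:R) isT isT
  N_gt0 (esym (mul1n N)) h_gt0 H_gt0.
apply: (degree_generic (gi_int gH) (gi_bounds0 gH) H_gt0 AH prodH isT).
by rewrite !expr1n mulr1 (generic_inequality_unit k_gt0) // (gi_ge gH).
Qed.

(** For [s = k] the identity [G = H] matters in the pairs of two 5s and two 7s: it puts the same
    conjugate twice into [4 a < g h], which rules out mixed pairs of roots. *)
Lemma degree_cases (s k : nat) (G H : S) :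
  (2 < s)%N -> (s <= k)%N -> (s = k -> G = H) -> gamma_index s G -> gamma_index k H ->
  (forall i, 4 * rho i A < rho i G * rho i H) ->
  path_dim_bound s k N.
Proof.
move=> s_gt2 le_sk GH gG gH AGH; have k_gt2 := leq_trans s_gt2 le_sk.
have [->|N_gt0] := posnP N; first by [].
have bG := gi_bounds gG; have bH := gi_bounds gH.
have AG i : rho i A < rho i G.
  have /andP[G_gt0 G_lt4] := bG i; have /andP[H_gt0 H_lt4] := bH i.
  by rewrite -(ltr_pM2l (ltr0n R 4)) (lt_trans (AGH i)) // mulrC ltr_pM2r.
have AH i : rho i A < rho i H.
  have /andP[G_gt0 G_lt4] := bG i; have /andP[H_gt0 H_lt4] := bH i.
  by rewrite -(ltr_pM2l (ltr0n R 4)) (lt_trans (AGH i)) // ltr_pM2r.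
have small : (N <= 20)%N -> path_dim_bound s k N.
  by move=> le; split=> *; lia.
have [k_special|k_gen] := boolP (k \in [:: 3; 4; 5; 7]%N); last first.
  exact/small/(degree_generic_index gH).
have [s_special|s_gen] := boolP (s \in [:: 3; 4; 5; 7]%N); last first.
  exact/small/(degree_generic_index gG).
have conj_lt2 (X : S) : X = 2 -> (forall i, rho i A < rho i X) -> (N <= 20)%N.
  move=> -> lt; suff : (N < 17)%N by lia.
  by apply: degree_conj_lt2 => i; have := lt i; rewrite rmorph_nat.
have [s4|s_n4] := eqVneq s 4%N; first exact/small/(conj_lt2 G)/AG/(gi_4 gG s4).
have [k4|k_n4] := eqVneq k 4%N; first exact/small/(conj_lt2 H)/AH/(gi_4 gH k4).
have prod5 X : gamma_index 5 X ->
    exists2 r, N = (2 * r)%N & \prod_(i < m) rho i X <= (5 ^+ r / rho0 X) ^+ e.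
  by move=> gX; apply: (@prod_le_prime_power 5 5 0).
have prod7 X : gamma_index 7 X ->
    exists2 r, N = (3 * r)%N & \prod_(i < m) rho i X <= (7 ^+ r / rho0 X) ^+ e.
  by move=> gX; apply: (@prod_le_prime_power 7 7 0).
have AG3 X : s = 3%N -> (forall i, 4 * rho i A < rho i G * rho i X) ->
    forall i, 4 * rho i A < 3 * rho i X.
  by move=> s3 lt i; have := lt i; rewrite (gi_3 gG s3) rmorph_nat.
move: k_special s_special; rewrite !inE (negbTE s_n4) (negbTE k_n4) /=.
case/or3P=> /eqP Dk; case/or3P=> /eqP Ds; subst s k => //=.
- suff : (N < 26)%N by split=> *; lia.
  apply: degree_conj_lt9_4 => i; have := AG3 _ erefl AGH i.
  by rewrite (gi_3 gH erefl) rmorph_nat; lra.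
- have [r NE prodH] := prod5 H gH; apply: small.
  have := degree_3_5 (gi_int gH) (gi_5 gH erefl) (gi_bounds0 gH) bH (AG3 _ erefl AGH) NE prodH.
  by lia.
- have [r NE prodH] := prod5 H gH; apply: small; rewrite GH // in AGH.
  have := degree_5_5 (gi_int gH) (gi_5 gH erefl) (gi_bounds0 gH) bH AGH NE prodH.
  by lia.
- have [r NE prodH] := prod7 H gH.
  have := degree_3_7 (gi_int gH) (gi_7 gH erefl) (gi_bounds0 gH) bH (AG3 _ erefl AGH) NE prodH.
  by split=> *; lia.
- have [r5 NE5 prodG] := prod5 G gG; have [r7 NE7 prodH] := prod7 H gH.
  have [r NE] : exists r, N = (6 * r)%N by exists (r5 %/ 3)%N; lia.
  have D5 : r5 = (3 * r)%N by lia. have D7 : r7 = (2 * r)%N by lia.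
  rewrite D5 in prodG; rewrite D7 in prodH; apply: small.
  have := degree_5_7 (gi_int gG) (gi_int gH) (gi_5 gG erefl) (gi_7 gH erefl)
    (gi_bounds0 gG) bG (gi_bounds0 gH) bH AGH NE prodG prodH.
  by lia.
- have [r NE prodH] := prod7 H gH; rewrite GH // in AGH.
  have := degree_7_7 (gi_int gH) (gi_7 gH erefl) (gi_bounds0 gH) bH AGH NE prodH.
  by split=> *; lia.
Qed.

End AuxiliaryFunction.

(** * The path matrix *)

(** The estimates need a totally ordered field, so embeddings with real values are given the target
    [algR] instead of [algC]. *)
Lemma real_embedding (L : fieldExtType rat) (K : {subfield L}) (f : {rmorphism L -> algC}) :
  (forall x, x \in K -> f x \is Creal) ->
  exists rho : {rmorphism subvs_of K -> algR}, forall x, algRval (rho x) = f (vsval x).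
Proof.
move=> real_f; pose h : {rmorphism subvs_of K -> algC} := f \o vsval.
pose g x := in_algR (real_f _ (subvsP x) : h x \is Creal).
have gB : zmod_morphism g by move=> x y; apply/val_inj/(rmorphB h).
have gM : monoid_morphism g.
  by split=> [|x y]; apply/val_inj; [apply: (rmorph1 h) | apply: (rmorphM h)].
pose gZ := GRing.isZmodMorphism.Build _ _ g gB; pose gR := GRing.isMonoidMorphism.Build _ _ g gM.
by exists (HB.pack_for {rmorphism subvs_of K -> algR} g gZ gR).
Qed.

Lemma gam_Aint (k : nat) (z : algC) : k.-primitive_root z -> gam z \in Aint.
Proof.
move=> prim_z; rewrite rpredB ?rpred_nat // rpredD ?(Aint_prim_root prim_z) //.
exact: (unity_Aint_inv prim_z).
Qed.

Lemma ler_algR (x y : algR) : (x <= y) = (algRval x <= algRval y). Proof. by []. Qed.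
Lemma ltr_algR (x y : algR) : (x < y) = (algRval x < algRval y). Proof. by []. Qed.

Section RealSubfield.

Variables (L : splittingFieldType rat) (iota : {rmorphism L -> algC}) (a : L) (m : nat).
Variable sg : 'I_m -> {rmorphism algC -> algC}.
Variables (rho0 : {rmorphism subvs_of <<1; a>>%AS -> algR})
  (rho : 'I_m -> {rmorphism subvs_of <<1; a>>%AS -> algR}).
Hypothesis rho0E : forall x, algRval (rho0 x) = iota (vsval x).
Hypothesis rhoE : forall i x, algRval (rho i x) = sg i (iota (vsval x)).

Lemma gamma_index_prim (k : nat) (z : L) (H : subvs_of <<1; a>>%AS) :
  (2 < k)%N -> iota z = k.-root (-1) ^+ 2 -> iota (vsval H) = gam (iota z) ->
  gamma_index (fun x => iota (vsval x) \in Aint) (\dim <<1; a>>) rho0 rho k H.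
Proof.
move=> k_gt2 Dz; pose phi : {rmorphism subvs_of <<1; a>>%AS -> algC} := iota \o vsval.
move=> DH; have phiH : phi H = gam (iota z) := DH.
have k_gt0 : (0 < k)%N by apply: leq_trans k_gt2.
have prim_z : k.-primitive_root (iota z) by rewrite Dz prim_root_rootCN1_sqr // ltnW.
have gE : gam (iota z) != 0 by have /andP[/gt_eqF->] := gam_bounds k_gt2 prim_z.
have nzH : H != 0 by rewrite -(fmorph_eq0 phi) phiH.
have Kz : z + z^-1 \in <<1; a>>%VS.
  have -> : z + z^-1 = 2 - vsval H.
    apply: (fmorph_inj iota); rewrite rmorphB rmorph_nat DH /gam opprB addrCA subrr addr0.
    by rewrite rmorphD fmorphV.
  by rewrite rpredB ?subvsP // rpred_nat.
split.
- by rewrite DH (gam_Aint prim_z).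
- have /andP[h_gt0 h_lt4] := gam_bounds k_gt2 prim_z.
  rewrite -rho0E in DH; apply/andP; split.
    by rewrite ltr_algR DH.
  by rewrite ltr_algR DH rmorph_nat.
(* A conjugate of [gam z] is [gam] at another primitive [k]-th root, so it obeys the same bounds. *)
- move=> i; have prim_sz : k.-primitive_root (sg i (iota z)) by rewrite fmorph_primitive_root.
  have /andP[h_gt0 h_lt4] := gam_bounds k_gt2 prim_sz.
  have {}DH : algRval (rho i H) = gam (sg i (iota z)).
    by rewrite rhoE DH /gam rmorphB rmorph_nat rmorphD fmorphV.
  apply/andP; split; first by rewrite ltr_algR DH.
  by rewrite ltr_algR DH rmorph_nat.
- rewrite ler_algR rho0E DH Dz.
  by rewrite fmorph_div rmorphXn !rmorph_nat gam_ge.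
- exact: (totient_dvd_dim k_gt0 prim_z Kz).
- move=> k3; rewrite k3 in prim_z; apply: (fmorph_inj phi).
  by rewrite phiH rmorph_nat gam_prim3.
- move=> k4; rewrite k4 in prim_z; apply: (fmorph_inj phi).
  by rewrite phiH rmorph_nat gam_prim4.
- move=> k5; rewrite k5 in prim_z; apply: (fmorph_inj phi).
  by rewrite !(rmorph_nat, rmorph0, rmorphXn, rmorphM, rmorphN, rmorphD) phiH gam_prim5.
- move=> k7; rewrite k7 in prim_z; apply: (fmorph_inj phi).
  by rewrite !(rmorph_nat, rmorph0, rmorphXn, rmorphM, rmorphN, rmorphD) phiH gam_prim7.
- move=> k11; rewrite k11 in prim_z; apply: (fmorph_inj phi).
  by rewrite !(rmorph_nat, rmorph0, rmorphXn, rmorphM, rmorphN, rmorphD) phiH gam_prim11.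
- move=> p q p_pr q_pr npq p_k q_k; exists H^-1; last by rewrite mulVf.
  by rewrite -[iota _]/(phi _) fmorphV phiH (gam_inv_Aint prim_z p_pr q_pr).
move=> p b n p_pr Dk tot; exists (p%:R / H ^+ n); last by rewrite divfK ?expf_neq0.
rewrite -[iota _]/(phi _) fmorph_div rmorphXn rmorph_nat phiH.
by rewrite Dk in prim_z tot; apply: gam_exp_prime_power p_pr prim_z tot.
Qed.

End RealSubfield.

Lemma path_dim_le (L : splittingFieldType rat) (iota : {rmorphism L -> algC})
    (s k : nat) (a zs zk : L) :
  galois 1 {:L} -> (2 < s)%N -> (s <= k)%N ->
  iota zs = s.-root (-1) ^+ 2 -> iota zk = k.-root (-1) ^+ 2 ->
  zs + zs^-1 \in <<1; a>>%VS -> zk + zk^-1 \in <<1; a>>%VS ->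
  iota a \in Aint -> 4 < iota a < 196 ->
  (forall nu : {rmorphism algC -> algC}, nu (iota a) \is Creal) ->
  (forall nu : {rmorphism algC -> algC}, nu (iota a) != iota a ->
     0 < 4 * nu (iota a) < nu (gam (iota zs)) * nu (gam (iota zk))) ->
  path_dim_bound s k (\dim <<1; a>>).
Proof.
move=> galL s_gt2 le_sk Ds Dk Ks Kk Za a_bounds a_real a_conj; set K := <<1; a>>%AS.
have [e [m [sg [e_gt0 mE sg_a norm_ge1]]]] := norm_ge1_conjugates iota galL a.
have real_K (nu : {rmorphism algC -> algC}) x : x \in K -> nu (iota x) \is Creal.
  case/Fadjoin_polyP=> p /polyOver1P[q ->] ->; rewrite -2!horner_map /= -2!map_poly_comp.
  apply: rpred_horner => //; apply/polyOverP => i; rewrite coef_map /=.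
  by rewrite alg_num_field !fmorph_rat rpred_rat.
have [rho0 rho0E] := real_embedding (f := iota) (real_K idfun).
have [rho rhoE] : exists rho : 'I_m -> {rmorphism subvs_of K -> algR},
    forall i x, algRval (rho i x) = sg i (iota (vsval x)).
  have [rho rhoE] := fin_all_exists (fun i => real_embedding (f := sg i \o iota) (real_K (sg i))).
  by exists rho.
have gam_mem z : z + z^-1 \in K -> exists H : subvs_of K, iota (vsval H) = gam (iota z).
  move=> Kz; have Kg : 2 - (z + z^-1) \in K by rewrite rpredB ?rpred_nat.
  by exists (Subvs Kg); rewrite /= rmorphB rmorph_nat rmorphD fmorphV.
have [G DG] := gam_mem _ Ks; have [H DH] := gam_mem _ Kk.
have gG := gamma_index_prim rho0E rhoE s_gt2 Ds DG.
have gH := gamma_index_prim rho0E rhoE (leq_trans s_gt2 le_sk) Dk DH.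
have DA : iota (vsval (Subvs (memv_adjoin 1 a) : subvs_of K)) = iota a by [].
set A := Subvs _ in DA.
have conjA i : 0 < 4 * sg i (iota a) < sg i (gam (iota zs)) * sg i (gam (iota zk)).
  exact/a_conj/sg_a.
move/andP: a_bounds => [a_gt4 a_lt196].
apply: (degree_cases e_gt0 mE _ _ _ _ _ _ _ _ s_gt2 le_sk _ gG gH (A := A)) => /=.
- by rewrite algid1 rmorph1.
- by move=> x y Ox Oy; rewrite rmorphB rpredB.
- by move=> x y Ox Oy; rewrite rmorphM rpredM.
- move=> x Ox nz; rewrite ler_algR.
  rewrite rmorphM rmorphXn rmorph_prod /= rho0E.
  under eq_bigr => i _ do rewrite rhoE.
  by apply: norm_ge1; rewrite ?subvsP.
- by rewrite DA.
- by rewrite ltr_algR rho0E DA rmorph_nat.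
- by rewrite ltr_algR rho0E DA rmorph_nat.
- move=> i; have /andP[c_gt0 _] := conjA i.
  by rewrite ltr_algR rhoE DA -(pmulr_rgt0 _ (ltr0n _ 4)).
- by move=> sk; apply/val_inj/(fmorph_inj iota); rewrite DG DH Ds Dk sk.
move=> i; have /andP[_] := conjA i; rewrite -DA -DG -DH -!rhoE => lt.
by rewrite ltr_algR !rmorphM rmorph_nat.
Qed.

Section PathMatrix.

Variables (s k : nat) (u : algC).
Hypotheses (s_gt2 : (2 < s)%N) (le_sk : (s <= k)%N).
Hypotheses (u_int : u \in Aint) (u_real : totally_real u) (u_gt2 : 2 < u) (u_lt14 : u < 14).
Hypothesis arithA : V_arithmetic (pathA u s k).

Let k_gt2 : (2 < k)%N. Proof. exact: leq_trans le_sk. Qed.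

Let u2_gt4 : 4 < u ^+ 2.
Proof. by have := ltr_pM (ler0n _ 2) (ler0n _ 2) u_gt2 u_gt2; rewrite -natrM -expr2. Qed.

(** By symmetry of the matrix the square of an entry is the cyclic product over [i, j]. *)
Lemma ground_field_entry_sqr (i j : 'I_4) : ground_field (pathA u s k) (pathA u s k i j ^+ 2).
Proof.
apply: gf_gen; exists [:: i; j] => //.
rewrite /cyclic_prod !big_cons big_nil mulr1 expr2; congr (_ * _).
by rewrite !mxE eq_sym; case: eqP => // _; case: i j => [[|[|[|[|?]]]] ?] [[|[|[|[|?]]]] ?].
Qed.

Lemma ground_field_sqr :
  [/\ ground_field (pathA u s k) (u ^+ 2),
      ground_field (pathA u s k) (two_cos_pi_div s ^+ 2) &
      ground_field (pathA u s k) (two_cos_pi_div k ^+ 2)].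
Proof.
have g := ground_field_entry_sqr.
by split; [have := g 0 1 | have := g 0 2 | have := g 1 3]; rewrite mxE.
Qed.

Lemma conj_two_cos_bounds (nu : {rmorphism algC -> algC}) (j : nat) :
  (2 < j)%N -> 0 < nu (gam (j.-root (-1) ^+ 2)) < 4.
Proof.
move=> j_gt2; have prim_z : j.-primitive_root (nu (j.-root (-1) ^+ 2)).
  by rewrite fmorph_primitive_root prim_root_rootCN1_sqr // ltnW.
have := gam_bounds j_gt2 prim_z.
by rewrite /gam rmorphB rmorph_nat rmorphD fmorphV.
Qed.

(* Evaluates the form at [(4 v, 2 g, 2 v c, g d)], the minimizer in the last two
   coordinates, where [v], [c], [d] are the conjugates of the entries of [pathA]
   and [g = 4 - c ^ 2]. *)
Lemma conj_neg_definite_lt (nu : {rmorphism algC -> algC}) :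
  neg_definite (map_mx nu (pathA u s k)) ->
  4 * nu (u ^+ 2) < nu (gam (s.-root (-1) ^+ 2)) * nu (gam (k.-root (-1) ^+ 2)).
Proof.
move=> neg; have [_ _ real_A _] := arithA.
have real_entry i j : nu (pathA u s k i j) \is Creal by apply/real_A/gf_gen; exists i, j.
have := real_entry 0 1; have := real_entry 0 2; have := real_entry 1 3.
rewrite !mxE /= => d_real c_real v_real.
have /andP[g_gt0 _] := conj_two_cos_bounds nu s_gt2.
have s_gt0 : (0 < s)%N by apply: leq_trans s_gt2.
have k_gt0 : (0 < k)%N by apply: leq_trans k_gt2.
move: g_gt0; rewrite !gam_two_cos // !rmorphB !rmorphXn !rmorph_nat.
set c := nu (two_cos_pi_div s) in c_real *; set d := nu (two_cos_pi_div k) in d_real *.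
set v := nu u in v_real *; set g := 4 - c ^+ 2 => g_gt0.
have g_real : g \is Creal by apply: gtr0_real.
pose x : 'cV[algC]_4 := \col_i [:: 4 * v; 2 * g; 2 * v * c; g * d]`_i.
have := neg x _ _; set q := (_ *m _) 0 0.
have -> : q = 2 * g * (4 * v ^+ 2 - g * (4 - d ^+ 2)).
  rewrite /q mxE !big_ord_recl big_ord0 !mxE !big_ord_recl !big_ord0 !mxE /= /bump /=.
  rewrite -/c -/d -/v !(rmorph0, rmorphN, rmorph_nat).
  by rewrite /g; ring.
rewrite pmulr_rlt0 ?mulr_gt0 // subr_lt0; apply.
  move=> i; rewrite mxE; case: i => [[|[|[|[|]]]]] //= _;
    by rewrite !rpredM ?rpred_nat.
apply/eqP => /colP/(_ 1); rewrite !mxE /= => /eqP.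
by rewrite mulf_eq0 pnatr_eq0 /= gt_eqF.
Qed.

Lemma ground_field_fixed (nu : {rmorphism algC -> algC}) (x : algC) :
  nu (u ^+ 2) = u ^+ 2 -> ground_field (pathA u s k) x -> nu x = x.
Proof.
move=> fix_a gx; have [_ _ _ neg] := arithA; have [//|/eqP move_x] := eqVneq (nu x) x.
have := conj_neg_definite_lt (neg nu (ex_intro _ x (conj gx move_x))); rewrite fix_a.
have /andP[g_gt0 g_lt4] := conj_two_cos_bounds nu s_gt2.
have /andP[h_gt0 h_lt4] := conj_two_cos_bounds nu k_gt2.
move=> lt; have := lt_trans lt (ltr_pM (ltW g_gt0) (ltW h_gt0) g_lt4 h_lt4).
rewrite ltr_pM2l // => /(lt_trans u2_gt4).
by rewrite ltxx.
Qed.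

(** [degree_le] concerns one finite list at a time, so a Galois number field built around that list
    suffices. In it all elements of the ground field lie in [Q(u^2)], whose dimension is the [N] of
    the statement. *)
Lemma ground_field_dependent (xs : seq algC) :
  (forall x, x \in xs -> ground_field (pathA u s k) x) ->
  exists N : nat,
   path_dim_bound s k N
   /\ ((N < size xs)%N -> exists c : seq rat, [/\ size c = size xs, c != nseq (size xs) 0 &
        \sum_(i < size xs) ratr c`_i * xs`_i = 0]).
Proof.
move=> g_xs; pose z j : algC := j.-root (-1) ^+ 2.
have [L [iota [galL lift]]] := galois_number_field [:: u ^+ 2, z s, z k & xs].
have [a Da] : exists y, iota y = u ^+ 2 by apply: lift; rewrite !inE eqxx.
have [zs Ds] : exists y, iota y = z s by apply: lift; rewrite !inE eqxx orbT.
have [zk Dk] : exists y, iota y = z k by apply: lift; rewrite !inE eqxx !orbT.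
have mem_K y : ground_field (pathA u s k) (iota y) -> y \in <<1; a>>%VS.
  by move=> gy; apply: (fixed_mem_Fadjoin (iota := iota) galL) => nu;
    rewrite Da => /ground_field_fixed->.
have [ga gs gk] := ground_field_sqr.
have mem_trace j y : (2 < j)%N -> iota y = z j -> ground_field (pathA u s k) (two_cos_pi_div j ^+ 2) ->
    y + y^-1 \in <<1; a>>%VS.
  move=> j_gt2 Dy gj; apply: mem_K.
  (* For [y = exp (2 pi i / j)] the trace [y + y^-1] is [(2 cos (pi / j))^2 - 2]. *)
  have -> : iota (y + y^-1) = two_cos_pi_div j ^+ 2 + ratr (- 2).
    rewrite rmorphD fmorphV Dy rmorphN rmorph_nat.
    have := gam_two_cos (ltnW (ltnW j_gt2)); rewrite /gam -/(z j) => /(canRL (subKr _))->.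
    by ring.
  by apply: gf_add => //; apply: gf_rat.
have [ys Dxs] : exists ys, map iota ys = xs.
  have : forall x, x \in xs -> exists y, iota y = x by move=> x xsx; apply: lift; rewrite !inE xsx !orbT.
  elim: (xs) => [|x l IHl] lift_l; first by exists [::].
  have [y Dy] := lift_l x (mem_head _ _).
  have [|ys <-] := IHl; first by move=> w lw; apply: lift_l; rewrite inE lw orbT.
  by exists (y :: ys); rewrite /= Dy.
exists (\dim <<1; a>>); split; last first.
  rewrite -Dxs size_map => /(dependent_dim iota)[] => [y ys_y|c [szc nz sum0]].
    by apply/mem_K/g_xs; rewrite -Dxs map_f.
  exists c; split=> //; apply: etrans sum0; apply: eq_bigr => i _.
  by rewrite (nth_map 0).
have u_gt0 : 0 < u by apply: lt_trans u_gt2.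
apply: (path_dim_le galL s_gt2 le_sk Ds Dk (mem_trace _ _ s_gt2 Ds gs) (mem_trace _ _ k_gt2 Dk gk)).
- by rewrite Da rpredX.
- rewrite Da; apply/andP; split=> //.
  by have := ltr_pM (ltW u_gt0) (ltW u_gt0) u_lt14 u_lt14; rewrite -natrM -expr2.
- by move=> nu; rewrite Da rmorphXn rpredX.
move=> nu; rewrite Da Ds Dk => move_a; apply/andP; split.
  rewrite pmulr_rgt0 // rmorphXn; have := u_real nu; rewrite realEsqr.
  by rewrite lt_neqAle eq_sym => ->; rewrite andbT expf_neq0 // fmorph_eq0 gt_eqF.
have [_ _ _ neg] := arithA; apply/conj_neg_definite_lt/neg.
by exists (u ^+ 2); split=> //; apply/eqP.
Qed.

End PathMatrix.

Theorem theorem4p12 (s k : nat) (u : algC) :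
  (3 <= s)%N -> (s <= k)%N ->
  u \in Aint -> totally_real u -> u \is Creal -> 2 < u -> u < 14 ->
  V_arithmetic (pathA u s k) ->
  [/\ (s = 3%N /\ k = 3%N -> degree_le (ground_field (pathA u s k)) 25),
      (s = 3%N /\ k = 7%N -> degree_le (ground_field (pathA u s k)) 21),
      (s = 7%N /\ k = 7%N -> degree_le (ground_field (pathA u s k)) 21),
      (~ (s = 3%N /\ k = 3%N) -> ~ (s = 3%N /\ k = 7%N) -> ~ (s = 7%N /\ k = 7%N) ->
         degree_le (ground_field (pathA u s k)) 20) &
      degree_le (ground_field (pathA u s k)) 25].
Proof.
move=> s_gt2 le_sk u_int u_real _ u_gt2 u_lt14 arithA.
by split=> *; move=> xs gxs lt_xs;
  have [N [[b33 b37 b77 b20] dep]] :=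
    ground_field_dependent s_gt2 le_sk u_int u_real u_gt2 u_lt14 arithA gxs;
  apply/dep/(leq_ltn_trans _ lt_xs); lia.
Qed.
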